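(* Let $\mathfrak{g}_{2|4}^{4}$ and $\mathfrak{g}_{2|4}^{3}(\lambda)$ ($\lambda\in\mathbb{C}$, $\lambda\neq0$) be the complex Lie superalgebras of dimension $2|4$ with basis $\{e_1,e_2\mid e_3,e_4,e_5,e_6\}$ ($e_1,e_2$ even, $e_3,\dots,e_6$ odd) and nontrivial brackets \begin{align*} \mathfrak{g}_{2|4}^{4}:\ &[e_2,e_3]=e_3,\ [e_2,e_4]=e_3+e_4,\ [e_2,e_5]=-e_5-e_6,\ [e_2,e_6]=-e_6,\ [e_3,e_5]=[e_4,e_5]=[e_4,e_6]=e_1;\\ \mathfrak{g}_{2|4}^{3}(\lambda):\ &[e_2,e_3]=e_3,\ [e_2,e_4]=\lambda e_4,\ [e_2,e_5]=-e_5,\ [e_2,e_6]=-\lambda e_6,\ [e_3,e_5]=e_1,\ [e_4,e_6]=\lambda e_1. \end{align*} Then $\mathfrak{g}_{2|4}^{4}$ has only one (nontrivial) metric deformation, up to equivalence and change of parameter, and it is a smooth deformation to the family $\mathfrak{g}_{2|4}^{3}(\lambda)$ around $\lambda=1$.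
   Context: All Lie superalgebras are over $\mathbb{C}$. Brackets of basis elements that are not listed are zero or determined by $[y,x]=-(-1)^{|x||y|}[x,y]$. A metric Lie superalgebra is a Lie superalgebra together with an even, non-degenerate, supersymmetric bilinear form $B$ that is invariant: $B([x,y],z)=B(x,[y,z])$. A formal 1-parameter deformation of a Lie superalgebra $(\mathfrak g,[\ ,\ ])$ is a $\mathbb{C}[[t]]$-bilinear Lie superalgebra structure on $\mathfrak g[[t]]=\mathfrak g\otimes_{\mathbb C}\mathbb{C}[[t]]$ of the form $[\ ,\ ]_t=[\ ,\ ]+\sum_{i\ge1}t^i\phi_i$, each $\phi_i:\mathfrak g\times\mathfrak g\to\mathfrak g$ being an even super-skew-symmetric bilinear map. Two such deformations $[\ ,\ ]_t,[\ ,\ ]'_t$ are equivalent if there is $\widehat\psi_t=\mathrm{id}+\psi_1t+\psi_2t^2+\cdots$ with even linear $\psi_i:\mathfrak g\to\mathfrak g$ and $\widehat\psi_t([x,y]_t)=[\widehat\psi_t(x),\widehat\psi_t(y)]'_t$ for all $x,y\in\mathfrak g$. A deformation is trivial if it is equivalent to the original bracket. A metric deformation is a formal 1-parameter deformation that defines a metric Lie superalgebra, i.e. $(\mathfrak g[[t]],[\ ,\ ]_t)$ admits an even, supersymmetric, invariant $\mathbb{C}[[t]]$-bilinear form that is non-degenerate over $\mathbb{C}[[t]]$ (induces an isomorphism with the dual module). A deformation is smooth if for different non-zero values of $t$ near the origin it defines non-isomorphic algebras (coincidences caused by symmetry being allowed). It is a smooth deformation to a family $\mathfrak h(\lambda)$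 around $\lambda_0$ if it is smooth and for non-zero $t$ near the origin it is isomorphic to $\mathfrak h(\lambda(t))$ with $\lambda(t)\to\lambda_0$ as $t\to0$. *)

(* Defs.v *)
From HB Require Import structures.
From mathcomp Require Import all_boot all_order all_algebra.
From mathcomp Require Import complex.
From mathcomp Require Import all_classical all_reals all_analysis.
Set Implicit Arguments.
Unset Strict Implicit.
Unset Printing Implicit Defensive.
Import Order.TTheory GRing.Theory Num.Theory numFieldNormedType.Exports.
Local Open Scope classical_set_scope.
Local Open Scope ring_scope.
Local Open Scope complex_scope.

(* [fps K] is K[[t]]; [f n] is the coefficient of t^n. *)
Definition fps (K : comNzRingType) : Type := nat -> K.

HB.instance Definition _ (K : comNzRingType) :=
  GRing.Zmodule.copy (fps K) (nat -> K).

Section FpsRing.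
Variable K : comNzRingType.
Implicit Types f g h : fps K.

Definition fps_const (a : K) : fps K := fun n => if n is 0%N then a else 0.

Definition fps_mul f g : fps K := fun n => \sum_(i < n.+1) f i * g (n - i)%N.

Lemma fps_mul_poly N n f g : (n <= N)%N ->
  fps_mul f g n = ((\poly_(i < N.+1) f i) * (\poly_(i < N.+1) g i))`_n.
Proof.
move=> nN; rewrite coefM; apply: eq_bigr => i _.
have iN : (i <= N)%N by apply: leq_trans nN; rewrite -ltnS.
by rewrite !coef_poly !ltnS iN (leq_trans (leq_subr _ _) nN).
Qed.

Lemma fps_mulA : associative fps_mul.
Proof.
move=> f g h; apply/funext => n.
pose P (u : fps K) := \poly_(i < n.+1) u i.
have PE u i : (i <= n)%N -> (P u)`_i = u i by rewrite coef_poly ltnS => ->.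
transitivity ((P f * (P g * P h))`_n); last rewrite mulrA.
  rewrite coefM; apply: eq_bigr => i _.
  by rewrite (@fps_mul_poly n) ?leq_subr // PE // -ltnS.
rewrite coefM; apply: eq_bigr => i _.
by rewrite (@fps_mul_poly n) -1?ltnS // PE ?leq_subr.
Qed.

Lemma fps_mulC : commutative fps_mul.
Proof.
by move=> f g; apply/funext => n; rewrite !(@fps_mul_poly n) // mulrC.
Qed.

Lemma fps_mul1 : left_id (fps_const 1) fps_mul.
Proof.
move=> f; apply/funext => n; rewrite /fps_mul big_ord_recl /= mul1r subn0.
by rewrite big1 ?addr0 // => i _; rewrite mul0r.
Qed.

Lemma fps_mulDl : left_distributive fps_mul +%R.
Proof.
move=> f g h; apply/funext => n.
rewrite /fps_mul /= -[RHS]/(_ n + _ n) -big_split /=.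
by apply: eq_bigr => i _; rewrite -mulrDl.
Qed.

Lemma fps_1_neq0 : fps_const 1 != 0 :> fps K.
Proof.
by apply/eqP => /(congr1 (@^~ 0%N)) /= /eqP; rewrite (oner_eq0 K).
Qed.

HB.instance Definition _ := GRing.Zmodule_isComNzRing.Build (fps K)
  fps_mulA fps_mulC fps_mul1 fps_mulDl fps_1_neq0.

(* The substitution f(s(t)); it is the usual one only if [s 0 = 0], in which
   case s^i has no term of degree less than i. *)
Definition fps_subst (s f : fps K) : fps K :=
  fun n => \sum_(i < n.+1) f i * (s ^+ i) n.

End FpsRing.

(* The free module K^{m|n} is 'rV[K]_(m + n): the first m basis vectors are
   even and the last n are odd. *)
Section LieSuperalgebras.
Variables (K : comNzRingType) (m n : nat).
Local Notation V := 'rV[K]_(m + n).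

Definition parity (i : 'I_(m + n)) : bool := (m <= i)%N.

Definition homogeneous (p : bool) (x : V) : Prop :=
  forall i, parity i != p -> x 0 i = 0.

Record is_lie_superalgebra (b : V -> V -> V) : Prop := {
  lie_linear_l : forall y, linear (b^~ y);
  lie_linear_r : forall x, linear (b x);
  lie_even : forall p q x y, homogeneous p x -> homogeneous q y ->
    homogeneous (p (+) q) (b x y);
  lie_skew : forall p q x y, homogeneous p x -> homogeneous q y ->
    b y x = - ((-1) ^+ (p && q) *: b x y);
  lie_jacobi : forall p q r x y z,
    homogeneous p x -> homogeneous q y -> homogeneous r z ->
    b x (b y z) = b (b x y) z + (-1) ^+ (p && q) *: b y (b x z) }.

Record is_metric_form (b : V -> V -> V) (B : V -> V -> K) : Prop := {
  form_linear_l : forall y, scalar (B^~ y);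
  form_linear_r : forall x, scalar (B x);
  form_even : forall p q x y, homogeneous p x -> homogeneous q y ->
    p != q -> B x y = 0;
  form_supersym : forall p q x y, homogeneous p x -> homogeneous q y ->
    B y x = (-1) ^+ (p && q) * B x y;
  form_invariant : forall x y z, B (b x y) z = B x (b y z);
  form_nondegenerate : forall f : V -> K, scalar f ->
    exists! x, forall y, B x y = f y }.

Definition even_map (f : V -> V) : Prop :=
  forall p x, homogeneous p x -> homogeneous p (f x).

Definition isomorphic (b b' : V -> V -> V) : Prop :=
  exists f : V -> V, [/\ linear f, bijective f, even_map f &
    forall x y, f (b x y) = b' (f x) (f y)].

Definition bilinear_extension (c : 'I_(m + n) -> 'I_(m + n) -> V) (x y : V) : V :=
  \sum_i \sum_j (x 0 i * y 0 j) *: c i j.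

(* [u i j] is the bracket of the basis vectors e_i and e_j, numbered from 1,
   for i <= j; the other brackets follow by super-skew-symmetry. *)
Definition bracket_of_table (u : nat -> nat -> V) : V -> V -> V :=
  bilinear_extension (fun i j =>
    if (i <= j)%N then u i.+1 j.+1
    else - ((-1) ^+ (parity i && parity j) *: u j.+1 i.+1)).

End LieSuperalgebras.

(* Applies h to all structure constants in the standard basis. *)
Definition map_bracket (K L : comNzRingType) (m n : nat) (h : K -> L)
    (b : 'rV[K]_(m + n) -> 'rV[K]_(m + n) -> 'rV[K]_(m + n)) :
    'rV[L]_(m + n) -> 'rV[L]_(m + n) -> 'rV[L]_(m + n) :=
  bilinear_extension (fun i j => map_mx h (b (delta_mx 0 i) (delta_mx 0 j))).

Section FormalDeformations.
Variables (K : comNzRingType) (m n : nat).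
Local Notation g := 'rV[K]_(m + n).
Local Notation gt := 'rV[fps K]_(m + n).

Definition constv (x : g) : gt := map_mx (@fps_const K) x.
Definition coefv (k : nat) (x : gt) : g := map_mx (fun f : fps K => f k) x.

(* The maps phi_k of [,]_t = [,] + \sum_k t^k phi_k are
   (x, y) |-> coefv k (b (constv x) (constv y)); those with k >= 1 are even
   and super-skew-symmetric because b is. *)
Definition formal_deformation (b0 : g -> g -> g) (b : gt -> gt -> gt) : Prop :=
  is_lie_superalgebra b /\
  forall x y, coefv 0 (b (constv x) (constv y)) = b0 x y.

Definition equivalent_deformations (b b' : gt -> gt -> gt) : Prop :=
  exists psi : gt -> gt,
    [/\ linear psi, even_map psi,
        forall x : g, coefv 0 (psi (constv x)) = x &
        forall x y : g, psi (b (constv x) (constv y)) =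
                        b' (psi (constv x)) (psi (constv y))].

Definition trivial_deformation (b0 : g -> g -> g) (b : gt -> gt -> gt) : Prop :=
  equivalent_deformations b (map_bracket (@fps_const K) b0).

Definition metric_deformation (b0 : g -> g -> g) (b : gt -> gt -> gt) : Prop :=
  formal_deformation b0 b /\ exists B, is_metric_form b B.

(* The change of parameter t |-> s(t), for s without constant term. *)
Definition reparametrize (s : fps K) (b : gt -> gt -> gt) : gt -> gt -> gt :=
  map_bracket (fps_subst s) b.

End FormalDeformations.

(* R[i]^o is R[i] with its norm topology. *)
Section SmoothDeformations.
Variables (R : realType) (m n : nat).
Local Notation g := 'rV[R[i]]_(m + n).
Local Notation gt := 'rV[fps R[i]]_(m + n).

Definition fps_psum (t : R[i]) (f : fps R[i]) (N : nat) : R[i]^o :=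
  \sum_(k < N) f k * t ^+ k.

Definition fps_eval (t : R[i]) (f : fps R[i]) : R[i] := limn (fps_psum t f).

Definition converges_at (t : R[i]) (b : gt -> gt -> gt) : Prop :=
  forall i j k, cvgn (fps_psum t (b (delta_mx 0 i) (delta_mx 0 j) 0 k)).

Definition bracket_at (t : R[i]) (b : gt -> gt -> gt) : g -> g -> g :=
  map_bracket (fps_eval t) b.

(* No coincidences at all are admitted among the algebras near the origin, not
   even those due to a symmetry of the parameter. *)
Definition smooth_deformation (b : gt -> gt -> gt) : Prop :=
  exists2 U : set R[i]^o, nbhs (0 : R[i]^o) U &
    (forall t, U t -> converges_at t b) /\
    (forall t t', U t -> U t' -> t != 0 -> t' != 0 -> t != t' ->
       ~ isomorphic (bracket_at t b) (bracket_at t' b)).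

(* The family h is indexed by the parameters in D. *)
Definition smooth_deformation_to (b : gt -> gt -> gt)
    (D : set R[i]) (h : R[i] -> g -> g -> g) (l0 : R[i]) : Prop :=
  smooth_deformation b /\
  exists l : R[i]^o -> R[i]^o,
    (\forall t \near (0 : R[i]^o)^',
       D (l t) /\ isomorphic (bracket_at t b) (h (l t))) /\
    l t @[t --> (0 : R[i]^o)^'] --> (l0 : R[i]^o).

End SmoothDeformations.

Section Algebras24.
Variable K : comNzRingType.

Definition e (k : nat) : 'rV[K]_(2 + 4) := \row_(i < 2 + 4) (i.+1 == k)%:R.

Definition g24_4 : 'rV[K]_(2 + 4) -> 'rV[K]_(2 + 4) -> 'rV[K]_(2 + 4) :=
  bracket_of_table (fun i j => match i, j with
    | 2%N, 3%N => e 3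
    | 2%N, 4%N => e 3 + e 4
    | 2%N, 5%N => - e 5 - e 6
    | 2%N, 6%N => - e 6
    | 3%N, 5%N => e 1
    | 4%N, 5%N => e 1
    | 4%N, 6%N => e 1
    | _, _ => 0
    end).

Definition g24_3 (l : K) : 'rV[K]_(2 + 4) -> 'rV[K]_(2 + 4) -> 'rV[K]_(2 + 4) :=
  bracket_of_table (fun i j => match i, j with
    | 2%N, 3%N => e 3
    | 2%N, 4%N => l *: e 4
    | 2%N, 5%N => - e 5
    | 2%N, 6%N => - (l *: e 6)
    | 3%N, 5%N => e 1
    | 4%N, 6%N => l *: e 1
    | _, _ => 0
    end).

End Algebras24.

(* Main.v *)
Require Import Defs.
From HB Require Import structures.
From mathcomp Require Import all_boot all_order all_algebra.
From mathcomp Require Import complex ring.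
From mathcomp Require Import all_classical all_reals all_analysis.
Import GRing.Theory.
Set Implicit Arguments.
Unset Strict Implicit.
Unset Printing Implicit Defensive.
Local Open Scope classical_set_scope.
Local Open Scope ring_scope.
Local Open Scope complex_scope.

(** Write D(s) for the action of e_2 on the odd part in which the two Jordan
    blocks of g24_4, for the eigenvalues 1 and -1, are deformed to have the
    eigenvalues 1 +- sqrt s and -1 +- sqrt s. The brackets given by D(t) form
    the versal metric deformation. Indeed, in any metric deformation an
    invariant form forces the even part to be abelian, and half of [f, f], for
    an odd f generating the odd part under X = ad e_2, is central by the Jacobi
    identity; the other odd brackets are then multiples of it. The matrix L of
    those brackets satisfies X L = - L X^T, so X^4 + a X^2 + b = 0, and after
    rescaling e_2 this polynomial is ((x - 1)^2 - s)((x + 1)^2 - s). Its two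
    factors provide a basis in which X is D(s) and L is in normal form.
    Distinct algebras of the family are told apart by
    (tr D^2)^2 : tr D^4, and D(r^2) is diagonal in a basis of eigenvectors with
    eigenvalues proportional to 1, l, -1, -l, where l = (1 - r) / (1 + r). *)

(** * Formal power series *)

(** The base is the local ring C[[t]], in which s need not have a square root, so that in general
    [X] has no eigenvectors to work with. This is why the normal form contains s and not its root.
    The two quadratic factors do exist over C[[t]] and have no common root at t = 0, so each of them
    cuts out the block of the other without any eigenvalue. Over C[[t]] a matrix is invertible as
    soon as its constant term is. Cyclicity of f and invertibility of X, of L and of the new basis
    are therefore all decided by explicit matrices at t = 0. An equivalence must moreover reduce to
    the identity at t = 0; this dictates the signs of the square roots and the seed vectors of the
    new basis. The relation X^4 + a X^2 + b = 0 has two free coefficients. Rescaling e_2 uses up one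
    of them, and s is what remains. The ratio of traces cannot tell s from 1/s, because the spectra
    of D(s) and D(1/s) are proportional. Near s = 0 this symmetry does no harm. *)

Section CoefficientZero.
Variable K : comNzRingType.

Definition fps_coef0 (f : fps K) : K := f 0%N.

Lemma fps_coef0_is_zmod_morphism : zmod_morphism fps_coef0.
Proof. by []. Qed.

Lemma fps_coef0_is_monoid_morphism : monoid_morphism fps_coef0.
Proof.
split=> // f g; rewrite /fps_coef0.
by rewrite -[LHS]/(\sum_(i < 1) f i * g (0 - i)%N) big_ord1.
Qed.

HB.instance Definition _ :=
  GRing.isZmodMorphism.Build (fps K) K fps_coef0 fps_coef0_is_zmod_morphism.
HB.instance Definition _ :=
  GRing.isMonoidMorphism.Build (fps K) K fps_coef0 fps_coef0_is_monoid_morphism.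

Lemma fps_const_is_zmod_morphism : zmod_morphism (@fps_const K).
Proof.
by move=> a b; apply/funext => -[|n] //=; rewrite -[RHS]/(0 - 0) subr0.
Qed.

Lemma fps_const_is_monoid_morphism : monoid_morphism (@fps_const K).
Proof.
split=> // a b; apply/funext => n.
rewrite -[RHS]/(\sum_(i < n.+1) fps_const a i * fps_const b (n - i)%N).
rewrite big_ord_recl /= subn0 big1 ?addr0 => [|i _]; last by rewrite mul0r.
by case: n => //= n; rewrite mulr0.
Qed.

HB.instance Definition _ :=
  GRing.isZmodMorphism.Build K (fps K) (@fps_const K) fps_const_is_zmod_morphism.
HB.instance Definition _ :=
  GRing.isMonoidMorphism.Build K (fps K) (@fps_const K)
    fps_const_is_monoid_morphism.

Lemma fps_mulE (f g : fps K) n : (f * g) n = \sum_(i < n.+1) f i * g (n - i)%N.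
Proof. by []. Qed.

Lemma fps_coef0M f g : fps_coef0 (f * g) = fps_coef0 f * fps_coef0 g.
Proof. exact: rmorphM. Qed.

Lemma fps_coef0B f g : fps_coef0 (f - g) = fps_coef0 f - fps_coef0 g.
Proof. by []. Qed.

Lemma red_mulmx m n p (M : 'M[fps K]_(m, n)) (N : 'M[fps K]_(n, p)) :
  map_mx fps_coef0 (M *m N) = map_mx fps_coef0 M *m map_mx fps_coef0 N.
Proof. exact: map_mxM. Qed.

Lemma redD m n (M N : 'M[fps K]_(m, n)) :
  map_mx fps_coef0 (M + N) = map_mx fps_coef0 M + map_mx fps_coef0 N.
Proof. exact: map_mxD. Qed.

Lemma redN m n (M : 'M[fps K]_(m, n)) :
  map_mx fps_coef0 (- M) = - map_mx fps_coef0 M.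
Proof. exact: map_mxN. Qed.

Lemma redZ m n a (M : 'M[fps K]_(m, n)) :
  map_mx fps_coef0 (a *: M) = fps_coef0 a *: map_mx fps_coef0 M.
Proof. exact: map_mxZ. Qed.

(** Course-of-values recursion on the coefficients; it yields inverses and square roots of
    series. *)
Lemma fps_causal_fixpoint (F : nat -> (nat -> K) -> K) :
  (forall n g g', (forall k, (k < n)%N -> g k = g' k) -> F n g = F n g') ->
  exists g : fps K, forall n, g n = F n g.
Proof.
move=> causal.
(* [pre n] has the final values below n; its values from n on are fillers. *)
pose fix pre n : nat -> K := if n is m.+1 then
  fun k => if (k < m)%N then pre m k else F m (pre m) else fun=> 0.
pose g : fps K := fun k => pre k.+1 k.
have preE n k : (k < n)%N -> pre n k = g k.
  elim: n => // n IHn; rewrite ltnS leq_eqVlt => /orP[/eqP -> //|kn] /=.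
  by rewrite kn IHn.
exists g => n; rewrite {1}/g /= ltnn.
by apply: causal => k; apply: preE.
Qed.

End CoefficientZero.

Lemma fps_inverse (K : fieldType) (f : fps K) : fps_coef0 f != 0 ->
  exists g, f * g = 1.
Proof.
rewrite /fps_coef0 => f0.
have [|g gE] := @fps_causal_fixpoint K (fun n g =>
  (f 0%N)^-1 * ((n == 0)%:R - \sum_(i < n) f i.+1 * g (n - i.+1)%N)).
  move=> n g g' gg'; congr (_ * (_ - _)); apply: eq_bigr => i _.
  by rewrite gg' // ltn_subrL; case: n i {gg'} => [[]|].
exists g; apply/funext => n; rewrite fps_mulE big_ord_recl subn0 [in f _ * g n]gE.
by rewrite mulrA divff // mul1r /bump /= subrK; case: n.
Qed.

Lemma fps_sqrt (K : numFieldType) (f : fps K) : fps_coef0 f = 1 ->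
  exists2 g, g * g = f & fps_coef0 g = 1.
Proof.
rewrite /fps_coef0 => f0.
(* As g has constant term 1, the coefficient of t^n in g^2, for n > 0, is twice that of g plus the
   products without index 0. *)
have [|g gE] := @fps_causal_fixpoint K (fun n g => if n is m.+1 then
    2^-1 * (f n - \sum_(i < m) g i.+1 * g (m - i)%N) else 1).
  case=> // m g g' gg'; congr (_ * (_ - _)); apply: eq_bigr => i _.
  by rewrite !gg' // ltnS ?leq_subr.
exists g; last by rewrite gE.
apply/funext => -[|m]; first by rewrite fps_mulE big_ord1 gE f0 mulr1.
rewrite fps_mulE big_ord_recl big_ord_recr subn0 /= /bump /= add1n subnn.
have g0 : g 0%N = 1 by rewrite gE.
rewrite g0 mulr1 mul1r gE.
set S := \sum_(i < m) _.
have := Num.Theory.pnatr_eq0 K 2; set h := 2^-1 => /negbT n2.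
have -> : h * (f m.+1 - S) + (S + h * (f m.+1 - S)) =
          (h * 2%:R) * (f m.+1 - S) + S by ring.
by rewrite mulVf // mul1r subrK.
Qed.

(** The determinant is a unit of K[[t]] because its constant term is one, and the adjugate does the
    rest. *)
Lemma mx_inverse_mod_t (K : fieldType) n (M : 'M[fps K]_n) :
  \det (map_mx (@fps_coef0 K) M) != 0 ->
  exists2 N, M *m N = 1%:M & N *m M = 1%:M.
Proof.
rewrite det_map_mx => /fps_inverse[d Md].
exists (d *: \adj M).
  by rewrite -scalemxAr mul_mx_adj scale_scalar_mx mulrC Md.
by rewrite -scalemxAl mul_adj_mx scale_scalar_mx mulrC Md.
Qed.

(** * Double extensions by a derivation *)

Lemma homogeneous_even (K : comNzRingType) m n (x : 'rV[K]_(m + n)) :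
  homogeneous false x <-> rsubmx x = 0.
Proof.
split=> [hx|rx i].
  by apply/rowP => j; rewrite !mxE; apply: hx; rewrite /parity /= leq_addr.
case: (split_ordP i) => j ->; rewrite /parity /=.
  by rewrite leqNgt ltn_ord.
by move: rx => /rowP/(_ j); rewrite !mxE.
Qed.

Lemma homogeneous_odd (K : comNzRingType) m n (x : 'rV[K]_(m + n)) :
  homogeneous true x <-> lsubmx x = 0.
Proof.
split=> [hx|lx i].
  by apply/rowP => j; rewrite !mxE; apply: hx; rewrite /parity /= leqNgt ltn_ord.
case: (split_ordP i) => j ->; rewrite /parity /=; last by rewrite leq_addr.
by move: lx => /rowP/(_ j); rewrite !mxE.
Qed.

Lemma linear_sum_delta (K : comNzRingType) n (V : lmodType K)
    (f : 'rV[K]_n -> V) : linear f ->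
  forall x, f x = \sum_i x 0 i *: f (delta_mx 0 i).
Proof.
move=> lf x.
pose fM := GRing.isLinear.Build K 'rV[K]_n V *:%R f lf.
pose fL : {linear 'rV[K]_n -> V} := HB.pack f fM.
rewrite -[f]/(fL : _ -> _) {1}(row_sum_delta x) linear_sum.
by apply: eq_bigr => i _; rewrite linearZ.
Qed.

Lemma eq_bilinear_extension (K : comNzRingType) m n
    (b : 'rV[K]_(m + n) -> 'rV[K]_(m + n) -> 'rV[K]_(m + n)) :
  (forall y, linear (b^~ y)) -> (forall x, linear (b x)) ->
  b = bilinear_extension (fun i j => b (delta_mx 0 i) (delta_mx 0 j)).
Proof.
move=> bl br; apply/funext => x; apply/funext => y.
rewrite (linear_sum_delta (bl y)); apply: eq_bigr => i _.
rewrite (linear_sum_delta (br _)) scaler_sumr.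
by apply: eq_bigr => j _; rewrite scalerA.
Qed.

Section DoubleExtension.
Variables (K : comNzRingType) (n : nat).
Implicit Types (D L W : 'M[K]_n) (x y z : 'rV[K]_(2 + n)).

(* D and L give ad e_2 and the bracket on the odd part, with D acting on rows. *)
Definition dext D L x y : 'rV[K]_(2 + n) :=
  row_mx ((rsubmx x *m L *m (rsubmx y)^T) 0 0 *: delta_mx 0 0)
    (lsubmx x 0 1 *: (rsubmx y *m D) - lsubmx y 0 1 *: (rsubmx x *m D)).

Lemma lsubmx_dext D L x y : lsubmx (dext D L x y) =
  (rsubmx x *m L *m (rsubmx y)^T) 0 0 *: delta_mx 0 0.
Proof. exact: row_mxKl. Qed.

Lemma rsubmx_dext D L x y : rsubmx (dext D L x y) =
  lsubmx x 0 1 *: (rsubmx y *m D) - lsubmx y 0 1 *: (rsubmx x *m D).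
Proof. exact: row_mxKr. Qed.

Lemma dext_linear_l D L y : linear ((dext D L)^~ y).
Proof.
move=> a x x'; rewrite /dext scale_row_mx add_row_mx; congr row_mx.
  rewrite scalerA -scalerDl; congr (_ *: _).
  by rewrite linearP /= !mulmxDl -!scalemxAl !mxE.
rewrite !linearP /= !mulmxDl -!scalemxAl.
set u := rsubmx x *m D; set v := rsubmx x' *m D; set w := rsubmx y *m D.
by apply/rowP => k; rewrite !mxE; ring.
Qed.

Lemma dext_linear_r D L x : linear (dext D L x).
Proof.
move=> a y y'; rewrite /dext scale_row_mx add_row_mx; congr row_mx.
  rewrite scalerA -scalerDl; congr (_ *: _).
  by rewrite !linearP /= !mxE.
rewrite !linearP /= !mulmxDl -!scalemxAl.
set u := rsubmx y *m D; set v := rsubmx y' *m D; set w := rsubmx x *m D.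
by apply/rowP => k; rewrite !mxE; ring.
Qed.

(** Since e_1 is central, the only Jacobi identity with content is that of e_2 and two odd vectors.
    It says that [D] is skew for the form [L]. *)
Lemma dext_lie D L : L^T = L -> D *m L = - (L *m D^T) ->
  is_lie_superalgebra (dext D L).
Proof.
move=> Lsym DL.
have bilC (u v : 'rV[K]_n) : u *m L *m v^T = v *m L *m u^T.
  have tr11 (M : 'M[K]_1) : M^T = M by apply/matrixP => i j; rewrite mxE !ord1.
  by rewrite -[LHS]tr11 !trmx_mul trmxK Lsym mulmxA.
split; [exact: dext_linear_l|exact: dext_linear_r| | |].
- move=> p q x y; case: p; case: q => /=;
    rewrite ?homogeneous_even ?homogeneous_odd ?rsubmx_dext ?lsubmx_dext
      => hx hy.
  + by rewrite hx hy !mxE !scale0r subrr.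
  + by rewrite hy trmx0 mulmx0 mxE scale0r.
  + by rewrite hx !mul0mx mxE scale0r.
  + by rewrite hx hy !mul0mx !scaler0 subrr.
- move=> p q x y hx hy; rewrite /dext -[in RHS]scaleNr scale_row_mx.
  congr row_mx; last first.
    rewrite -opprB; case: p q hx hy => -[];
      rewrite ?homogeneous_even ?homogeneous_odd => hx hy;
      rewrite ?expr0 ?expr1 ?scaleN1r ?opprK ?scale1r ?opprB //.
    by rewrite hx hy !mxE !scale0r subrr.
  rewrite bilC; case: p q hx hy => -[];
    rewrite ?homogeneous_even ?homogeneous_odd => hx hy;
    rewrite ?expr0 ?expr1 ?opprK ?scale1r // scaleN1r;
    by rewrite ?hx ?hy ?mul0mx ?trmx0 ?mulmx0 mxE scale0r oppr0.
- have d01 : (delta_mx 0 0 : 'rV[K]_2) 0 1 = 0 by rewrite mxE.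
  have lsub01 u v : lsubmx (dext D L u v) 0 1 = 0.
    by rewrite lsubmx_dext mxE d01 mulr0.
  move=> p q r x y z hx hy hz.
  pose beta (u v : 'rV[K]_n) := (u *m L *m v^T) 0 0.
  have betaDl u v w a b : beta (a *: u - b *: v) w = a * beta u w - b * beta v w.
    by rewrite /beta !mulmxBl -!scalemxAl !mxE.
  have betaC u v : beta u v = beta v u by rewrite /beta bilC.
  have betaD u v : beta (u *m D) v = - beta u (v *m D).
    rewrite /beta -!mulmxA (mulmxA D) DL trmx_mul mulNmx mulmxN mxE.
    by rewrite !mulmxA.
  have beta0 u : beta 0 u = 0 by rewrite /beta !mul0mx mxE.
  rewrite [LHS]/dext [X in _ = X + _]/dext [X in _ = _ + _ *: X]/dext.
  rewrite !lsub01 !rsubmx_dext !scale0r !add0r !subr0 scale_row_mx add_row_mx.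
  congr row_mx.
    rewrite scalerA -scalerDl; congr (_ *: _).
    rewrite -!/(beta _ _) [LHS]betaC [X in _ * X]betaC !betaDl !betaD.
    have key u v : beta u (v *m D) = - beta v (u *m D) by rewrite betaC betaD.
    have beta0r u : beta u 0 = 0 by rewrite betaC.
    rewrite (key (rsubmx z) (rsubmx x)) (key (rsubmx y) (rsubmx x)).
    rewrite (key (rsubmx z) (rsubmx y)).
    case: p q hx hy => -[] /=; rewrite ?homogeneous_even ?homogeneous_odd
      => hx hy; rewrite ?hx ?hy ?expr0 ?expr1 ?[(0 : 'rV_2) 0 1]mxE
        ?mul0mx ?beta0r ?beta0; ring.
  rewrite !mulmxBl -!scalemxAl.
  set u := rsubmx x *m D *m D; set v := rsubmx y *m D *m D.
  set w := rsubmx z *m D *m D.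
  have [u0 v0] : (p = false -> u = 0) /\ (q = false -> v = 0).
    split=> p0.
      by move: hx; rewrite /u p0 homogeneous_even => ->; rewrite !mul0mx.
    by move: hy; rewrite /v p0 homogeneous_even => ->; rewrite !mul0mx.
  have [l0 m0] : (p -> lsubmx x 0 1 = 0) /\ (q -> lsubmx y 0 1 = 0).
    split=> p1.
      by move: hx; rewrite p1 homogeneous_odd => ->; rewrite mxE.
    by move: hy; rewrite p1 homogeneous_odd => ->; rewrite mxE.
  move: u v w (lsubmx x 0 1) (lsubmx y 0 1) (lsubmx z 0 1) u0 v0 l0 m0.
  move=> u v w lx ly lz; case: p q {hx hy} => -[] u0 v0 l0 m0;
    rewrite ?(u0 erefl) ?(v0 erefl) ?(l0 isT) ?(m0 isT) ?expr0 ?expr1;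
    by apply/rowP => k; rewrite !mxE; ring.
Qed.

Definition hyperbolic_mx : 'M[K]_2 := \matrix_(i, j) (i != j)%:R.

Definition dext_form (w : 'M[K]_n) x y : K :=
  (x *m block_mx hyperbolic_mx 0 0 w *m y^T) 0 0.

Lemma dext_formE w x y : dext_form w x y =
  lsubmx x 0 0 * lsubmx y 0 1 + lsubmx x 0 1 * lsubmx y 0 0 +
  (rsubmx x *m w *m (rsubmx y)^T) 0 0.
Proof.
rewrite /dext_form -{1}(hsubmxK x) -{1}(hsubmxK y) tr_row_mx mul_row_block.
rewrite !mulmx0 addr0 add0r mul_row_col mxE; congr (_ + _).
rewrite mxE !big_ord_recl big_ord0 !mxE !big_ord_recl !big_ord0 !mxE /=.
have -> : lift ord0 ord0 = 1 :> 'I_2 by apply: val_inj.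
by rewrite !(mulr0, mulr1, addr0, add0r) addrC.
Qed.

(** Invariance forces L = D w: the e_1-coefficient of [u, v] is B(e_2, [u, v]) = B([e_2, u], v) =
    w(u D, v). The algebra is the double extension of the odd space with the skew form [w] by the
    derivation [D]. *)
Lemma dext_form_metric D w w' : w^T = - w -> w *m w' = 1%:M ->
  D *m w = - (w *m D^T) -> is_metric_form (dext D (D *m w)) (dext_form w).
Proof.
move=> wT ww' Dw.
have zE k l i j : (0 : 'M[K]_(k, l)) i j = 0 by rewrite mxE.
have nE (M : 'M[K]_1) i j : (- M) i j = - M i j by rewrite mxE.
have w'w := mulmx1C ww'.
have wC (u v : 'rV[K]_n) : u *m w *m v^T = - (v *m w *m u^T).
  have tr11 (M : 'M[K]_1) : M^T = M by apply/matrixP => i j; rewrite mxE !ord1.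
  by rewrite -[LHS]tr11 !trmx_mul trmxK wT mulNmx mulmxN mulmxA.
split.
- by move=> y a x x'; rewrite /dext_form !mulmxDl -!scalemxAl !mxE.
- by move=> x a y y'; rewrite /dext_form linearP /= mulmxDr -scalemxAr !mxE.
- move=> p q x y hx hy pq; rewrite dext_formE.
  case: p q hx hy pq => -[] //; rewrite ?homogeneous_even ?homogeneous_odd
    => hx hy _; rewrite hx hy ?trmx0 ?mul0mx ?mulmx0 !zE; ring.
- move=> p q x y hx hy; rewrite !dext_formE.
  rewrite (wC (rsubmx y)).
  case: p q hx hy => -[] //; rewrite ?homogeneous_even ?homogeneous_odd
    => hx hy; rewrite nE hx hy ?trmx0 ?mul0mx ?mulmx0 ?zE
      /= ?expr0 ?expr1; ring.
- move=> x y z; rewrite !dext_formE !lsubmx_dext !rsubmx_dext.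
  pose gam (u v : 'rV[K]_n) := (u *m w *m v^T) 0 0.
  have gamBl a b u v t : gam (a *: u - b *: v) t = a * gam u t - b * gam v t.
    by rewrite /gam !mulmxBl -!scalemxAl !mxE.
  have gamBr a b u v t : gam t (a *: u - b *: v) = a * gam t u - b * gam t v.
    have gamC s r : gam s r = - gam r s.
      by rewrite /gam wC nE.
    by rewrite gamC gamBl ![gam t _]gamC; ring.
  have gamD u v : gam (u *m D) v = - gam u (v *m D).
    rewrite /gam -!mulmxA (mulmxA D) Dw trmx_mul mulNmx mulmxN mxE.
    by rewrite !mulmxA.
  have gamDw u v : (u *m (D *m w) *m v^T) 0 0 = gam (u *m D) v.
    by rewrite /gam !mulmxA.
  have d00 : (delta_mx 0 0 : 'rV[K]_2) 0 0 = 1 by rewrite mxE.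
  have d01 : (delta_mx 0 0 : 'rV[K]_2) 0 1 = 0 by rewrite mxE.
  rewrite !gamDw -!/(gam _ _) gamBl gamBr ![(_ *: delta_mx 0 0) _ _]mxE d00 d01.
  rewrite !gamD; ring.
- move=> f lf.
  have lf' : linear (f : _ -> K^o) by [].
  pose v : 'rV[K]_(2 + n) := \row_i f (delta_mx 0 i).
  have fE y : f y = (v *m y^T) 0 0.
    rewrite (linear_sum_delta lf') mxE; apply: eq_bigr => i _.
    by rewrite !mxE [RHS]mulrC.
  pose G := block_mx hyperbolic_mx 0 0 w; pose G' := block_mx hyperbolic_mx 0 0 w'.
  have hh : hyperbolic_mx *m hyperbolic_mx = 1%:M.
    apply/matrixP => i j; rewrite !mxE !big_ord_recl big_ord0 !mxE /=.
    by case: i j => [[|[|//]] ?] [[|[|//]] ?];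
      rewrite -!(inj_eq val_inj) /=; ring.
  have GG' : G *m G' = 1%:M.
    by rewrite mulmx_block !(mulmx0, mul0mx, addr0, add0r) hh ww' -scalar_mx_block.
  have G'G := mulmx1C GG'.
  exists (v *m G'); split=> [y|x xE].
    by rewrite /dext_form -/G -(mulmxA v) G'G mulmx1 fE.
  suff -> : v = x *m G by rewrite -mulmxA GG' mulmx1.
  apply/rowP => i; rewrite mxE -xE /dext_form -/G trmx_delta -colE.
  by rewrite mxE.
Qed.

(** The even block of [M] is diag(a, b). The two hypotheses express compatibility with ad e_2 and
    with the odd bracket, whose values lie on the line of e_1. *)
Lemma dext_block_mx a b W D L D' L' x y :
  b *: (W *m D') = D *m W -> W *m L' *m W^T = a *: L ->
  let M := block_mx (\matrix_(i < 2, j < 2) (if i == j then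
     if i == 0 then a else b else 0)) 0 0 W in
  dext D' L' (x *m M) (y *m M) = dext D L x y *m M.
Proof.
move=> WD WL; set d := \matrix_(i, j) _ => M.
have d01 (u : 'rV[K]_2) : (u *m d) 0 1 = u 0 1 * b.
  rewrite !mxE !big_ord_recl big_ord0 !mxE /= mulr0 add0r addr0.
  by congr (u _ _ * _); apply: val_inj.
have subM z : lsubmx (z *m M) = lsubmx z *m d /\ rsubmx (z *m M) = rsubmx z *m W.
  rewrite -{1 3}(hsubmxK z) mul_row_block !mulmx0 addr0 add0r.
  by rewrite row_mxKl row_mxKr.
rewrite /dext !(subM x).1 !(subM x).2 !(subM y).1 !(subM y).2 !d01.
rewrite mul_row_block !mulmx0 addr0 add0r; congr row_mx.
  rewrite trmx_mul -!mulmxA (mulmxA W) (mulmxA _ W^T) WL -!scalemxAl -!scalemxAr.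
  rewrite !mulmxA mxE mulrC -scalerA; congr (_ *: _).
  apply/rowP => j; rewrite !mxE !big_ord_recl big_ord0 !mxE /=.
  case: j => [[|[|//]] ?]; rewrite -!(inj_eq val_inj) /=; ring.
rewrite mulmxBl -!scalemxAl -!mulmxA -WD -!scalemxAr !scalerA.
by [].
Qed.

End DoubleExtension.

Lemma dext_delta (K : comNzRingType) n (D L : 'M[K]_n) (i j : 'I_(2 + n)) :
  dext D L (delta_mx 0 i) (delta_mx 0 j) =
  match fintype.split i, fintype.split j with
  | inl a, inl b => 0
  | inl a, inr b => row_mx 0 ((a == 1)%:R *: row b D)
  | inr a, inl b => row_mx 0 (- ((b == 1)%:R *: row a D))
  | inr a, inr b => row_mx (L a b *: delta_mx 0 0) 0
  end.
Proof.
have zE k l a b : (0 : 'M[K]_(k, l)) a b = 0 by rewrite mxE.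
have dl (a : 'I_2) : delta_mx 0 (lshift n a) =
    row_mx (delta_mx 0 a) 0 :> 'rV[K]_(2 + n).
  apply/rowP => k; case: (split_ordP k) => k' ->.
    by rewrite row_mxEl !mxE (inj_eq (@lshift_inj _ _)).
  by rewrite row_mxEr !mxE eq_rlshift andbF.
have dr (a : 'I_n) : delta_mx 0 (rshift 2 a) =
    row_mx 0 (delta_mx 0 a) :> 'rV[K]_(2 + n).
  apply/rowP => k; case: (split_ordP k) => k' ->.
    by rewrite row_mxEl !mxE eq_lrshift andbF.
  by rewrite row_mxEr !mxE (inj_eq (@rshift_inj _ _)).
rewrite -{1}(splitK i) -{1}(splitK j).
case: (fintype.split i) => a; case: (fintype.split j) => b /=;
  rewrite ?dl ?dr /dext !row_mxKl !row_mxKr ?mul0mx ?trmx0 ?mulmx0 !zE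
    ?scale0r ?scaler0 ?subrr ?subr0 ?sub0r.
- exact: row_mx0.
- by rewrite -rowE mxE eqxx eq_sym.
- by rewrite -rowE mxE eqxx eq_sym.
- by rewrite -rowE trmx_delta -colE !mxE.
Qed.

(** [h] is not assumed to be a ring morphism, because it will also be the evaluation at t, a limit
    that is meaningless on divergent series. Up to sign, every structure constant is 0 or an entry
    of [D] or [L]. *)
Lemma map_bracket_dext (K K' : comNzRingType) n (h : K -> K') (D L : 'M[K]_n) :
  h 0 = 0 -> (forall i j, h (- D i j) = - h (D i j)) ->
  map_bracket h (dext D L) = dext (map_mx h D) (map_mx h L).
Proof.
move=> h0 hN; rewrite [RHS]eq_bilinear_extension; last 2 first.
- exact: dext_linear_l.
- exact: dext_linear_r.
congr bilinear_extension; apply/funext => i; apply/funext => j.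
rewrite !dext_delta; case: (fintype.split i) => a; case: (fintype.split j) => b.
- by apply/rowP => k; rewrite !mxE.
- rewrite map_row_mx; congr row_mx; apply/rowP => k; rewrite !mxE //.
  by case: (a == 1); rewrite ?mul1r ?mul0r.
- rewrite map_row_mx; congr row_mx; apply/rowP => k; rewrite !mxE //.
  by case: (b == 1); rewrite ?mul1r ?mul0r ?oppr0.
- rewrite map_row_mx; congr row_mx; apply/rowP => k; rewrite !mxE //.
  by case: (k == 0); rewrite ?mulr1 ?mulr0.
Qed.

(** * The algebras of dimension 2|4 *)

Definition mx4 (K : nzRingType) (rows : seq (seq K)) : 'M[K]_4 :=
  \matrix_(i, j) (nth [::] rows i)`_j.

Lemma map_mx4 (K K' : nzRingType) (h : K -> K') rows : h 0 = 0 ->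
  map_mx h (mx4 rows) = mx4 (map (map h) rows).
Proof.
move=> h0; apply/matrixP => i j; rewrite !mxE.
case: (ltnP i (size rows)) => hi; last first.
  by rewrite !(nth_default [::]) ?size_map //= !nth_nil.
rewrite (nth_map [::]) //; set r := nth [::] _ _.
case: (ltnP j (size r)) => hj; first by rewrite (nth_map 0).
by rewrite !nth_default ?size_map.
Qed.

Section DeformedBracket.
Variable K : comNzRingType.
Implicit Types s l : K.

(* The eigenvalues are 1 +- sqrt s and -1 +- sqrt s: a nonzero s splits
   the two Jordan blocks of ad e_2 in g24_4. *)
Definition dmx s : 'M[K]_4 := mx4
  [:: [:: 1; s; 0; 0]; [:: 1; 1; 0; 0]; [:: 0; 0; -1; -1]; [:: 0; 0; - s; -1]].

Definition symplectic_mx : 'M[K]_4 := mx4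
  [:: [:: 0; 0; 1; 0]; [:: 0; 0; 0; 1]; [:: -1; 0; 0; 0]; [:: 0; -1; 0; 0]].

Definition lmx s : 'M[K]_4 := mx4
  [:: [:: 0; 0; 1; s]; [:: 0; 0; 1; 1]; [:: 1; 1; 0; 0]; [:: s; 1; 0; 0]].

Definition versal_bracket s := dext (dmx s) (lmx s).

Definition dmx3 l : 'M[K]_4 := mx4
  [:: [:: 1; 0; 0; 0]; [:: 0; l; 0; 0]; [:: 0; 0; -1; 0]; [:: 0; 0; 0; - l]].

Definition lmx3 l : 'M[K]_4 := mx4
  [:: [:: 0; 0; 1; 0]; [:: 0; 0; 0; l]; [:: 1; 0; 0; 0]; [:: 0; l; 0; 0]].

Ltac mx4_ring := apply/matrixP => -[[|[|[|[|//]]]] ?] [[|[|[|[|//]]]] ?];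
  rewrite !mxE ?big_ord_recl ?big_ord0 ?mxE /=; ring.

Lemma lmxE s : lmx s = dmx s *m symplectic_mx. Proof. mx4_ring. Qed.

Lemma tr_lmx s : (lmx s)^T = lmx s. Proof. mx4_ring. Qed.

Lemma dmx_lmx s : dmx s *m lmx s = - (lmx s *m (dmx s)^T).
Proof. mx4_ring. Qed.

Lemma dmx_symplectic s :
  dmx s *m symplectic_mx = - (symplectic_mx *m (dmx s)^T).
Proof. mx4_ring. Qed.

Lemma tr_symplectic : symplectic_mx^T = - symplectic_mx.
Proof. mx4_ring. Qed.

Lemma mul_symplectic_tr : symplectic_mx *m - symplectic_mx = 1%:M.
Proof. mx4_ring. Qed.

Lemma versal_bracket_lie s : is_lie_superalgebra (versal_bracket s).
Proof. exact: dext_lie (tr_lmx s) (dmx_lmx s). Qed.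

Lemma versal_bracket_metric s :
  is_metric_form (versal_bracket s) (dext_form symplectic_mx).
Proof.
rewrite /versal_bracket lmxE.
exact: dext_form_metric tr_symplectic mul_symplectic_tr (dmx_symplectic s).
Qed.

Lemma bracket_of_table_dext n (u : nat -> nat -> 'rV[K]_(2 + n)) (D L : 'M[K]_n) :
  L^T = L ->
  (forall i j : nat, (i < 2)%N -> (j < 2)%N -> u i.+1 j.+1 = 0) ->
  (forall (a : 'I_2) (b : 'I_n),
     u a.+1 b.+3 = row_mx 0 ((a == 1)%:R *: row b D)) ->
  (forall a b : 'I_n, (a <= b)%N ->
     u a.+3 b.+3 = row_mx (L a b *: delta_mx 0 0) 0) ->
  bracket_of_table u = dext D L.
Proof.
move=> Lsym u00 u01 u11; rewrite [RHS]eq_bilinear_extension; last 2 first.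
- exact: dext_linear_l.
- exact: dext_linear_r.
congr bilinear_extension; apply/funext => i; apply/funext => j.
rewrite dext_delta -{1 2 3 4}(splitK i) -{1 2 3 4}(splitK j) /parity.
case: (fintype.split i) => a; case: (fintype.split j) => b /=.
- by rewrite !u00 // scaler0 oppr0; case: ifP.
- by rewrite ltnW ?ltn_addr // u01.
- rewrite leqNgt ltn_addr //= u01 leqNgt ltn_ord /= expr0 scale1r.
  by rewrite opp_row_mx oppr0.
- rewrite leq_add2l; case: leqP => [ab|/ltnW ba]; first by rewrite u11.
  by rewrite u11 // expr1 scaleN1r opprK -{1}Lsym mxE.
Qed.

Lemma g24_4_dext : @g24_4 K = versal_bracket 0.
Proof.
apply: bracket_of_table_dext => [|[|[|//]] [|[|//]] //| |].
- exact: tr_lmx.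
- move=> [[|[|//]] ?] [[|[|[|[|//]]]] ?] /=; apply/rowP => k;
    case: (split_ordP k) => k' ->; rewrite ?row_mxEl ?row_mxEr;
    case: k' => [[|[|[|[|//]]]] ?] //; rewrite !mxE /=; ring.
- move=> [[|[|[|[|//]]]] ?] [[|[|[|[|//]]]] ?] //= _; apply/rowP => k;
    case: (split_ordP k) => k' ->; rewrite ?row_mxEl ?row_mxEr;
    case: k' => [[|[|[|[|//]]]] ?] //; rewrite !mxE /=; ring.
Qed.

Lemma g24_3_dext l : g24_3 l = dext (dmx3 l) (lmx3 l).
Proof.
apply: bracket_of_table_dext => [|[|[|//]] [|[|//]] //| |].
- mx4_ring.
- move=> [[|[|//]] ?] [[|[|[|[|//]]]] ?] /=; apply/rowP => k;
    case: (split_ordP k) => k' ->; rewrite ?row_mxEl ?row_mxEr;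
    case: k' => [[|[|[|[|//]]]] ?] //; rewrite !mxE /=; ring.
- move=> [[|[|[|[|//]]]] ?] [[|[|[|[|//]]]] ?] //= _; apply/rowP => k;
    case: (split_ordP k) => k' ->; rewrite ?row_mxEl ?row_mxEr;
    case: k' => [[|[|[|[|//]]]] ?] //; rewrite !mxE /=; ring.
Qed.

End DeformedBracket.

Lemma map_bracket_versal_bracket (K K' : comNzRingType) (h : K -> K') (s : K) :
  h 0 = 0 -> h 1 = 1 -> h (- 1) = - 1 -> h (- s) = - h s ->
  map_bracket h (versal_bracket s) = versal_bracket (h s).
Proof.
move=> h0 h1 hN1 hNs; rewrite /versal_bracket map_bracket_dext //.
  by rewrite !map_mx4 //= h0 h1 hN1 hNs.
move=> -[[|[|[|[|//]]]] ?] [[|[|[|[|//]]]] ?];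
  by rewrite !mxE /= ?opprK ?hN1 ?hNs ?h1 ?oppr0 ?h0 ?oppr0 ?opprK.
Qed.

(** * Normal form of the odd part *)

Definition rv4 (K : nzRingType) (r : seq K) : 'rV[K]_4 := \row_j r`_j.

Definition rows4 (K : nzRingType) (w : seq 'rV[K]_4) : 'M[K]_4 :=
  \matrix_(i < 4) w`_i.

Lemma mul_rv4_dmx (K : comNzRingType) (a b c d s : K) :
  rv4 [:: a; b; c; d] *m dmx s =
  rv4 [:: a + b; s * a + b; - c - s * d; - c - d].
Proof.
apply/rowP => -[[|[|[|[|//]]]] ?]; rewrite !mxE !big_ord_recl big_ord0 !mxE /=;
  ring.
Qed.

(* Multiplication by gpoly projects, up to a unit, onto the part of Y near 1, and
   by fpoly onto the part near -1; adjunction for L exchanges the two. *)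
Section JordanBasis.
Variables (A : comNzRingType) (Y L : 'M[A]_4) (s : A).
Hypotheses (Lsym : L^T = L) (YL : Y *m L = - (L *m Y^T)).

Definition fpoly : {poly A} := ('X - 1) ^+ 2 - s%:P.
Definition gpoly : {poly A} := ('X + 1) ^+ 2 - s%:P.

Hypothesis fg0 : horner_mx Y (fpoly * gpoly) = 0.

Local Notation pr v w := ((v *m L *m w^T) 0 0).

Lemma mul_fg : horner_mx Y fpoly *m horner_mx Y gpoly = 0.
Proof. by rewrite mulmxE -[RHS]fg0 rmorphM. Qed.

Lemma mul_gf : horner_mx Y gpoly *m horner_mx Y fpoly = 0.
Proof. by rewrite mulmxE -[RHS]fg0 mulrC rmorphM. Qed.

Lemma pairC (v w : 'rV[A]_4) : pr v w = pr w v.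
Proof.
have tr11 (M : 'M[A]_1) : M^T = M by apply/matrixP => i j; rewrite mxE !ord1.
by rewrite -[v *m L *m _]tr11 !trmx_mul trmxK Lsym mulmxA.
Qed.

Lemma pairMY (v w : 'rV[A]_4) : pr (v *m Y) w = - pr v (w *m Y).
Proof.
by rewrite -!mulmxA (mulmxA Y) YL trmx_mul mulNmx mulmxN [LHS]mxE !mulmxA.
Qed.

Lemma pairDl (u v w : 'rV[A]_4) : pr (u + v) w = pr u w + pr v w.
Proof. by rewrite !mulmxDl mxE. Qed.

Lemma pairZl a (u w : 'rV[A]_4) : pr (a *: u) w = a * pr u w.
Proof. by rewrite -!scalemxAl mxE. Qed.

Lemma pairDr (u v w : 'rV[A]_4) : pr w (u + v) = pr w u + pr w v.
Proof. by rewrite ![pr w _]pairC pairDl. Qed.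

Lemma pairZr a (u w : 'rV[A]_4) : pr w (a *: u) = a * pr w u.
Proof. by rewrite ![pr w _]pairC pairZl. Qed.

Lemma mul_quadratic (v : 'rV[A]_4) a b :
  v *m horner_mx Y ('X * 'X + a%:P * 'X + b%:P) =
  v *m Y *m Y + a *: (v *m Y) + b *: v.
Proof.
rewrite !rmorphD !rmorphM /= !horner_mx_C horner_mx_X -!mulmxE.
by rewrite !mulmxDr !mulmxA !mul_mx_scalar scalemxAl.
Qed.

Lemma mul_fpoly (v : 'rV[A]_4) :
  v *m horner_mx Y fpoly = v *m Y *m Y + (-2) *: (v *m Y) + (1 - s) *: v.
Proof.
rewrite -mul_quadratic /fpoly polyCN polyCB polyC1 polyC_natr.
by congr (_ *m horner_mx _ _); ring.
Qed.

Lemma mul_gpoly (v : 'rV[A]_4) :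
  v *m horner_mx Y gpoly = v *m Y *m Y + 2 *: (v *m Y) + (1 - s) *: v.
Proof.
rewrite -mul_quadratic /gpoly polyCB polyC1 polyC_natr.
by congr (_ *m horner_mx _ _); ring.
Qed.

(** [gpoly] is [fpoly] with 'X replaced by - 'X, and - Y is the adjoint of Y for the form [L]. *)
Lemma pair_gpoly (v w : 'rV[A]_4) :
  pr (v *m horner_mx Y gpoly) w = pr v (w *m horner_mx Y fpoly).
Proof.
rewrite mul_gpoly mul_fpoly !(pairDl, pairZl, pairDr, pairZr) !pairMY; ring.
Qed.

(** The vectors e_4 and e_5 generate the two blocks of [dmx s]; its second and third rows then force
    e_3 = e_4 (Y - 1) and e_6 = - e_5 (Y + 1). *)
Definition basis3 (z : 'rV[A]_4) :=
  z *m horner_mx Y gpoly *m Y - z *m horner_mx Y gpoly.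
Definition basis4 (z : 'rV[A]_4) := z *m horner_mx Y gpoly.
Definition basis5 (z : 'rV[A]_4) := z *m horner_mx Y fpoly.
Definition basis6 (z : 'rV[A]_4) :=
  - (z *m horner_mx Y fpoly *m Y) - z *m horner_mx Y fpoly.

(** The map - (Y + 1) commutes with Y, sends [basis5 z'] to [basis6 z'] and sends [basis6 z'] to
    [s *: basis5 z']. The last two rows are the images of these vectors under p - q (Y + 1); p and q
    give the freedom to normalise the pairing of the two blocks. *)
Definition jordan_basis (z z' : 'rV[A]_4) (p q : A) : 'M[A]_4 :=
  rows4 [:: basis3 z; basis4 z; p *: basis5 z' + q *: basis6 z';
            p *: basis6 z' + (q * s) *: basis5 z'].

Lemma basis4Y z : basis4 z *m Y = basis3 z + basis4 z.
Proof. by rewrite /basis3 subrK. Qed.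

Lemma basis3Y z : basis3 z *m Y = basis3 z + s *: basis4 z.
Proof.
have : basis4 z *m horner_mx Y fpoly = 0.
  by rewrite /basis4 -mulmxA mul_gf mulmx0.
rewrite mul_fpoly; set w := basis4 z => w0.
have w3 : basis3 z = w *m Y - w by [].
rewrite -[RHS]addr0 -w0 w3 mulmxBl.
move: (w *m Y *m Y) (w *m Y) => u v; clearbody w.
by apply/rowP => k; rewrite !mxE; ring.
Qed.

Lemma basis5Y z : basis5 z *m Y = - basis5 z - basis6 z.
Proof. by rewrite /basis6 opprB opprK addKr. Qed.

Lemma basis6Y z : basis6 z *m Y = - basis6 z - s *: basis5 z.
Proof.
have : basis5 z *m horner_mx Y gpoly = 0.
  by rewrite /basis5 -mulmxA mul_fg mulmx0.
rewrite mul_gpoly; set w := basis5 z => w0.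
have w3 : basis6 z = - (w *m Y) - w by [].
rewrite -[RHS]subr0 -w0 w3 mulmxBl mulNmx.
move: (w *m Y *m Y) (w *m Y) => u v; clearbody w.
by apply/rowP => k; rewrite !mxE; ring.
Qed.

Lemma jordan_basis_mul z z' p q :
  jordan_basis z z' p q *m Y = dmx s *m jordan_basis z z' p q.
Proof.
apply/row_matrixP => i; rewrite !row_mul rowK.
have -> w0 w1 w2 w3 : row i (dmx s) *m rows4 [:: w0; w1; w2; w3] =
    [:: w0 + s *: w1; w0 + w1; - w2 - w3; - (s *: w2) - w3]`_i.
  rewrite mulmx_sum_row !big_ord_recl big_ord0 !rowK.
  by case: i => [[|[|[|[|//]]]] ?]; rewrite !mxE /=;
    rewrite ?scale1r ?scale0r ?scaleN1r ?scaleNr ?addr0 ?add0r.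
case: i => [[|[|[|[|//]]]] ?] /=.
- exact: basis3Y.
- exact: basis4Y.
- rewrite mulmxDl -!scalemxAl basis5Y basis6Y.
  by move: (basis5 _) (basis6 _) => u v; apply/rowP => k; rewrite !mxE; ring.
- rewrite mulmxDl -!scalemxAl basis5Y basis6Y.
  by move: (basis5 _) (basis6 _) => u v; apply/rowP => k; rewrite !mxE; ring.
Qed.

(** Each block is isotropic by adjunction, and the pairings of e_3 follow from those of e_4 because
    Y is skew. The two hypotheses normalise what is left, namely the pairings of e_4 with e_6 and
    with e_5. *)
Lemma jordan_basis_pair z z' p q :
  let al := pr (basis4 z) (basis6 z') in let ga := pr (basis4 z) (basis5 z') in
  p * al + q * s * ga = 1 -> p * ga + q * al = 1 ->
  jordan_basis z z' p q *m L *m (jordan_basis z z' p q)^T = lmx s.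
Proof.
move=> al ga al1 ga1.
have g0 (u v : 'rV_4) : pr (u *m horner_mx Y gpoly) (v *m horner_mx Y gpoly) = 0.
  rewrite pair_gpoly -(mulmxA v) mul_gf.
  by rewrite mulmx0 trmx0 mulmx0 mxE.
have f0 (u v : 'rV_4) : pr (u *m horner_mx Y fpoly) (v *m horner_mx Y fpoly) = 0.
  rewrite -pair_gpoly -(mulmxA u) mul_fg.
  by rewrite mulmx0 !mul0mx mxE.
have polyY (u : 'rV_4) (h : {poly A}) :
    u *m horner_mx Y h *m Y = u *m Y *m horner_mx Y h.
  rewrite -!mulmxA -{2 3}(horner_mx_X Y); congr (u *m _).
  by rewrite !mulmxE -!rmorphM /= mulrC.
have pair0 : [/\ pr (basis4 z) (basis4 z) = 0, pr (basis3 z) (basis4 z) = 0 &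
                 pr (basis3 z) (basis3 z) = 0].
  by rewrite /basis3 /basis4 polyY -mulmxBl !g0.
have pair0' : [/\ pr (basis5 z') (basis5 z') = 0, pr (basis6 z') (basis5 z') = 0 &
                 pr (basis6 z') (basis6 z') = 0].
  by rewrite /basis5 /basis6 polyY -mulNmx -mulmxBl !f0.
have m35 : pr (basis3 z) (basis5 z') = al.
  rewrite /al -[basis3 z](addrK (basis4 z)) -basis4Y -scaleN1r pairDl pairZl.
  rewrite pairMY basis5Y -!scaleN1r pairDr !pairZr; ring.
have m36 : pr (basis3 z) (basis6 z') = s * ga.
  rewrite /ga -[basis3 z](addrK (basis4 z)) -basis4Y -scaleN1r pairDl pairZl.
  rewrite pairMY basis6Y -!scaleN1r pairDr !pairZr; ring.
have [p44 p34 p33] := pair0; have [p55 p65 p66] := pair0'.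
have entry i j : (jordan_basis z z' p q *m L *m (jordan_basis z z' p q)^T) i j =
    pr (row i (jordan_basis z z' p q)) (row j (jordan_basis z z' p q)).
  rewrite tr_row -row_mul [LHS]mxE [RHS]mxE.
  by apply: eq_bigr => k _; rewrite [in RHS]mxE [X in _ = _ * X]mxE.
apply/matrixP => i j; rewrite entry !rowK [RHS]mxE {entry}.
(* From here on only bilinearity, symmetry and ten values of the pairing count. *)
pose h (v w : 'rV[A]_4) : A := pr v w.
have hC v w : h v w = h w v by exact: pairC.
have hDl u v w : h (u + v) w = h u w + h v w by exact: pairDl.
have hZl a u w : h (a *: u) w = a * h u w by exact: pairZl.
rewrite -[LHS]/(h _ _).
change (h (basis4 z) (basis4 z) = 0) in p44.
change (h (basis3 z) (basis4 z) = 0) in p34.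
change (h (basis3 z) (basis3 z) = 0) in p33.
change (h (basis5 z') (basis5 z') = 0) in p55.
change (h (basis6 z') (basis5 z') = 0) in p65.
change (h (basis6 z') (basis6 z') = 0) in p66.
change (h (basis3 z) (basis5 z') = al) in m35.
change (h (basis3 z) (basis6 z') = s * ga) in m36.
have m46 : h (basis4 z) (basis6 z') = al by [].
have m45 : h (basis4 z) (basis5 z') = ga by [].
clearbody h al ga; clear g0 f0 polyY pair0 pair0'.
move: (basis3 z) (basis4 z) (basis5 z') (basis6 z') p44 p34 p33 p55 p65 p66
  m35 m36 m45 m46 => b3 b4 b5 b6 p44 p34 p33 p55 p65 p66 m35 m36 m45 m46.
have hDr u v w : h w (u + v) = h w u + h w v by rewrite ![h w _]hC hDl.
have hZr a u w : h w (a *: u) = a * h w u by rewrite ![h w _]hC hZl.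
have hE := (hDl, hZl, hDr, hZr, hC b4 b3, hC b5 b3, hC b6 b3, hC b5 b4, hC b6 b4,
  hC b5 b6, p44, p34, p33, p55, p65, p66, m35, m36, m45, m46).
case: i j => [[|[|[|[|//]]]] ?] [[|[|[|[|//]]]] ?] /=; rewrite !hE;
  first [ring | rewrite -[RHS]al1; ring | rewrite -[RHS]ga1; ring
        | rewrite -[RHS]mulr1 -[X in _ = _ * X]ga1; ring].
Qed.

End JordanBasis.

Lemma mul_rv4_rows4 (K : comNzRingType) (a b c d : K) (w0 w1 w2 w3 : 'rV[K]_4) :
  rv4 [:: a; b; c; d] *m rows4 [:: w0; w1; w2; w3] =
  a *: w0 + b *: w1 + c *: w2 + d *: w3.
Proof.
rewrite mulmx_sum_row !big_ord_recl big_ord0 !rowK !mxE /=.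
by rewrite addr0 !addrA.
Qed.

Lemma map_rv4 (K K' : nzRingType) (h : K -> K') r : h 0 = 0 ->
  map_mx h (rv4 r) = rv4 (map h r).
Proof.
move=> h0; apply/rowP => j; rewrite !mxE.
case: (ltnP j (size r)) => hj; first by rewrite (nth_map 0).
by rewrite !nth_default ?size_map.
Qed.

Lemma eq_rv4 (K : nzRingType) (a b c d a' b' c' d' : K) :
  a = a' -> b = b' -> c = c' -> d = d' ->
  rv4 [:: a; b; c; d] = rv4 [:: a'; b'; c'; d'].
Proof. by move=> -> -> -> ->. Qed.

(** * Cyclic vectors and the quartic relation *)

Section EvenMinimalPolynomial.
Variables (A : comNzRingType) (X L L' C' : 'M[A]_4) (f : 'rV[A]_4).
Definition krylov_mx : 'M[A]_4 :=
  rows4 [:: f; f *m X; f *m X *m X; f *m X *m X *m X].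
Local Notation C := krylov_mx.
Hypotheses (CC' : C *m C' = 1%:M) (C'C : C' *m C = 1%:M).

(** Commuting with X, P kills the whole Krylov basis of f once it kills f. *)
Lemma cyclic_kernel (P : 'M[A]_4) : P *m X = X *m P -> f *m P = 0 -> P = 0.
Proof.
move=> PX fP; suff CP : C *m P = 0 by rewrite -[P]mul1mx -C'C -mulmxA CP mulmx0.
have step (v : 'rV[A]_4) : v *m P = 0 -> v *m X *m P = 0.
  by rewrite -mulmxA -PX mulmxA => ->; rewrite mul0mx.
apply/row_matrixP => i; rewrite row_mul rowK row0.
have p1 := step _ fP; have p2 := step _ p1; have p3 := step _ p2.
by case: i => [[|[|[|[|//]]]] ?].
Qed.

Hypotheses (XL : X *m L = - (L *m X^T)) (L'L : L' *m L = 1%:M).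
Hypothesis no_2torsion : forall x : A, x = - x -> x = 0.

Let pol (a b c d : A) (T : 'M[A]_4) :=
  a%:M + b *: T + c *: (T *m T) + d *: (T *m T *m T).

Lemma mul_cyclic_pol a b c d : f *m pol a b c d X = rv4 [:: a; b; c; d] *m C.
Proof.
rewrite mul_rv4_rows4 /pol !mulmxDr mul_mx_scalar.
by rewrite -!scalemxAr !mulmxA.
Qed.

Lemma mul_adjoint_pol a b c d :
  pol a b c d X *m L = L *m (pol a (- b) c (- d) X)^T.
Proof.
have X2 : X *m X *m L = L *m X^T *m X^T.
  by rewrite -mulmxA XL mulmxN mulmxA XL mulNmx opprK.
have X3 : X *m X *m X *m L = - (L *m X^T *m X^T *m X^T).
  by rewrite -(mulmxA _ X L) XL mulmxN mulmxA X2.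
rewrite /pol !linearD /= !linearZ /= tr_scalar_mx !trmx_mul.
rewrite !mulmxDl -!scalemxAl X2 X3 XL scalar_mxC.
by rewrite !scalerN !scaleNr !mulmxA.
Qed.

Lemma mul_adjoint_X4 : X *m X *m X *m X *m L = L *m (X *m X *m X *m X)^T.
Proof.
have X2 : X *m X *m L = L *m X^T *m X^T.
  by rewrite -mulmxA XL mulmxN mulmxA XL mulNmx opprK.
rewrite -(mulmxA _ X X) -(mulmxA (X *m X)) X2 !mulmxA X2 !trmx_mul.
by rewrite !mulmxA.
Qed.

(* X is L-adjoint to -X, so the relation of degree 4 satisfied by the cyclic
   vector f also holds with the odd coefficients negated. *)
Lemma even_quartic : exists a b : A, X *m X *m X *m X + a *: (X *m X) + b%:M = 0.
Proof.
(* The coordinates of f X^4 in the Krylov basis; by cyclicity the relation they express on f holds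
   for X itself. *)
pose c := f *m (X *m X *m X *m X) *m C'.
pose c0 := c 0 0; pose c1 := c 0 1; pose c2 := c 0 (inord 2); pose c3 := c 0 (inord 3).
have cE : c = rv4 [:: c0; c1; c2; c3].
  by apply/rowP => k; rewrite [RHS]mxE; case: k => [[|[|[|[|//]]]] ?] /=;
    congr (c _ _); apply: val_inj; rewrite /= ?inordK.
have polX : X *m X *m X *m X = pol c0 c1 c2 c3 X.
  apply/eqP; rewrite -subr_eq0; apply/eqP; apply: cyclic_kernel.
    rewrite /pol mulmxBl mulmxBr; congr (_ - _); first by rewrite !mulmxA.
    by rewrite !mulmxDl !mulmxDr scalar_mxC -!scalemxAl -!scalemxAr !mulmxA.
  by rewrite mulmxBr mul_cyclic_pol -cE /c -(mulmxA _ C' C) C'C mulmx1 subrr.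
have polX' : X *m X *m X *m X = pol c0 (- c1) c2 (- c3) X.
  apply: trmx_inj; rewrite -[LHS]mul1mx -[RHS]mul1mx -L'L -!(mulmxA L').
  congr (L' *m _); rewrite -mul_adjoint_pol.
  by rewrite -mul_adjoint_X4 polX.
have cE' : c = rv4 [:: c0; - c1; c2; - c3].
  by rewrite /c polX' mul_cyclic_pol -mulmxA CC' mulmx1.
have c10 : c1 = 0.
  by apply: no_2torsion; move/rowP/(_ 1): cE'; rewrite [RHS]mxE.
have c30 : c3 = 0.
  apply: no_2torsion; move/rowP/(_ (inord 3)): cE'.
  by rewrite [RHS]mxE /= inordK.
exists (- c2), (- c0); rewrite polX /pol c10 c30 !scale0r !addr0 scaleNr addrK.
by rewrite raddfN subrr.
Qed.

End EvenMinimalPolynomial.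

Lemma fps_natmul_eq0 (K : numFieldType) n (x : fps K) : x *+ n.+1 = 0 -> x = 0.
Proof.
have mulrnE k j : (x *+ k) j = x j *+ k.
  elim: k => // k IHk; rewrite !mulrS.
  by rewrite -[LHS]/(x j + (x *+ k) j) IHk.
move=> xn; apply/funext => j; apply/eqP.
rewrite -[_ == _](Num.Theory.mulrn_eq0 (x j) n.+1).
by rewrite -mulrnE xn.
Qed.

Lemma fps_no_2torsion (K : numFieldType) (x : fps K) : x = - x -> x = 0.
Proof. by move=> xN; apply: (@fps_natmul_eq0 _ 1); rewrite mulr2n {1}xN addNr. Qed.

Section NormalForm.
Variables (K : numFieldType) (X L : 'M[fps K]_4).
Local Notation A := (fps K).
Local Notation c0 := (@fps_coef0 K).
Local Notation red := (map_mx c0).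
Hypotheses (Lsym : L^T = L) (XL : X *m L = - (L *m X^T)).
Hypotheses (X0 : red X = dmx 0) (L0 : red L = lmx 0).

Variable f : 'rV[A]_4.
Hypothesis f0 : red f = rv4 [:: 0; 1; 1; 0].
Local Notation C := (krylov_mx X f).

(** The inverse of the Krylov matrix at t = 0, which up to order and signs of its columns is the
    confluent Vandermonde matrix of the double nodes 1 and -1. *)
Let N0 : 'M[K]_4 := mx4
  [:: [:: - 4^-1; - 4^-1; 4^-1; 4^-1]; [:: 2^-1; 3 / 4; 0; - 4^-1];
      [:: 2^-1; - (3 / 4); 0; 4^-1]; [:: - 4^-1; 4^-1; 4^-1; - 4^-1]].

(** At t = 0, f is e_4 + e_5, the sum of generators of the two Jordan blocks. It is cyclic because
    their eigenvalues 1 and -1 differ. *)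
Lemma red_krylov : [/\ red f = rv4 [:: 0; 1; 1; 0],
  red (f *m X) = rv4 [:: 1; 1; -1; -1],
  red (f *m X *m X) = rv4 [:: 2; 1; 1; 2],
  red (f *m X *m X *m X) = rv4 [:: 3; 1; -1; -3] &
  red (f *m X *m X *m X *m X) = rv4 [:: 4; 1; 1; 4]].
Proof.
have step (v : 'rV[A]_4) a b c d : red v = rv4 [:: a; b; c; d] ->
    red (v *m X) = rv4 [:: a + b; 0 * a + b; - c - 0 * d; - c - d].
  by move=> v0; rewrite red_mulmx v0 X0 mul_rv4_dmx.
have r1 := step _ _ _ _ _ f0; have r2 := step _ _ _ _ _ r1.
have r3 := step _ _ _ _ _ r2; have r4 := step _ _ _ _ _ r3.
split; [exact: f0|rewrite r1|rewrite r2|rewrite r3|rewrite r4];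
  by apply: eq_rv4; ring.
Qed.

Lemma red_krylov_mx : red C *m N0 = 1%:M.
Proof.
have [r0 r1 r2 r3 _] := red_krylov.
have -> : red C = mx4 [:: [:: 0; 1; 1; 0]; [:: 1; 1; -1; -1];
    [:: 2; 1; 1; 2]; [:: 3; 1; -1; -3]].
  apply/row_matrixP => i; rewrite -map_row rowK.
  case: i => [[|[|[|[|//]]]] ?] /=; rewrite ?r0 ?r1 ?r2 ?r3;
    by apply/rowP => k; rewrite !mxE.
apply/matrixP => -[[|[|[|[|//]]]] ?] [[|[|[|[|//]]]] ?];
  rewrite !mxE !big_ord_recl big_ord0 !mxE /=; by field.
Qed.

Lemma krylov_inverse : exists2 C' : 'M[A]_4, C *m C' = 1%:M & C' *m C = 1%:M.
Proof.
apply: mx_inverse_mod_t; rewrite -unitfE -unitmxE.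
by case/mulmx1_unit: red_krylov_mx.
Qed.

Lemma L_inverse : exists2 L' : 'M[A]_4, L *m L' = 1%:M & L' *m L = 1%:M.
Proof.
apply: mx_inverse_mod_t; rewrite L0 -unitfE -unitmxE.
suff /mulmx1_unit[]: lmx (0 : K) *m mx4 [:: [:: 0; 0; 1; -1]; [:: 0; 0; 0; 1];
  [:: 1; 0; 0; 0]; [:: -1; 1; 0; 0]] = 1%:M by [].
apply/matrixP => -[[|[|[|[|//]]]] ?] [[|[|[|[|//]]]] ?];
  rewrite !mxE !big_ord_recl big_ord0 !mxE /=; ring.
Qed.

Lemma quartic : exists a b : A, [/\ c0 a = -2, c0 b = 1 &
  X *m X *m X *m X + a *: (X *m X) + b%:M = 0].
Proof.
have [C' CC' C'C] := krylov_inverse; have [L' _ L'L] := L_inverse.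
have [a [b ab0]] := even_quartic CC' C'C XL L'L (@fps_no_2torsion K).
exists a, b; suff [a0 b0] : c0 a = -2 /\ c0 b = 1 by [].
have [_ _ r2 _ r4] := red_krylov.
(* Applied to f at t = 0, the relation reads 4 + 2 a = 0 in the e_3-coordinate and 1 + a + b = 0 in
   the e_4-coordinate. *)
have : red (f *m X *m X *m X *m X + a *: (f *m X *m X) + b *: f) = 0.
  have -> : f *m X *m X *m X *m X + a *: (f *m X *m X) + b *: f =
      f *m (X *m X *m X *m X + a *: (X *m X) + b%:M).
    by rewrite !mulmxDr -scalemxAr mul_mx_scalar !mulmxA.
  by rewrite ab0 mulmx0 map_mx0.
rewrite !redD !redZ r4 r2 f0 => /rowP r.
have := r 0; rewrite !mxE /= mulr0 addr0 => a2.
have a0 : c0 a = -2.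
  have n2 : (2 : K) != 0 by rewrite Num.Theory.pnatr_eq0.
  by apply: (mulIf n2); rewrite -[LHS](addKr 4) a2; ring.
have := r 1; rewrite !mxE /= a0 => b1; split=> //.
by apply/eqP; rewrite -subr_eq0; apply/eqP; rewrite -b1; ring.
Qed.

End NormalForm.

Lemma red_pair (K : comNzRingType) n (v w : 'rV[fps K]_n) (L : 'M[fps K]_n) :
  fps_coef0 ((v *m L *m w^T) 0 0) =
  (map_mx (@fps_coef0 K) v *m map_mx (@fps_coef0 K) L *m
   (map_mx (@fps_coef0 K) w)^T) 0 0.
Proof. by rewrite map_trmx -!red_mulmx [RHS]mxE. Qed.

Lemma rv4_lmx0 (K : comNzRingType) (a b c d a' b' c' d' : K) :
  (rv4 [:: a; b; c; d] *m lmx 0 *m (rv4 [:: a'; b'; c'; d'])^T) 0 0 =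
  a * c' + b * c' + b * d' + c * a' + c * b' + d * b'.
Proof.
by rewrite !mxE !big_ord_recl big_ord0 !mxE !big_ord_recl !big_ord0 !mxE /=; ring.
Qed.

Lemma horner_fg (A : comNzRingType) (Y : 'M[A]_4) (s : A) :
  horner_mx Y (fpoly s * gpoly s) =
  Y *m Y *m Y *m Y + (-2 * (1 + s)) *: (Y *m Y) + ((1 - s) * (1 - s))%:M.
Proof.
have -> : fpoly s * gpoly s = 'X * 'X * 'X * 'X +
    (-2 * (1 + s))%:P * ('X * 'X) + ((1 - s) * (1 - s))%:P.
  rewrite /fpoly /gpoly !polyCM polyCN polyC_natr polyCD polyCB polyC1; ring.
move: (-2 * _) (_ * (1 - s)) => a b.
by rewrite !rmorphD !rmorphM /= !horner_mx_C horner_mx_X -!mulmxE mul_scalar_mx.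
Qed.

(** Comparison of coefficients for v X asks for (be v^2)^2 = (1 - s)^2 and a v^2 = -2 (1 + s).
    Taking 1 - s = be v^2 turns the second equation into a = 2 be - 4 u^2, where u = 1/v. *)
Lemma rescaled_quartic (A : comNzRingType) (X : 'M[A]_4) (a be u v : A) :
  X *m X *m X *m X + a *: (X *m X) + (be * be)%:M = 0 ->
  a = 2 * be - 4 * (u * u) -> u * v = 1 ->
  let s := 1 - be * v * v in horner_mx (v *: X) (fpoly s * gpoly s) = 0.
Proof.
move=> quart aE uv s; rewrite horner_fg.
have mulv k (M : 'M[A]_4) : k *: M *m (v *: X) = (k * v) *: (M *m X).
  by rewrite -scalemxAl -scalemxAr scalerA.
rewrite !mulv; have -> : X *m X *m X *m X = - (a *: (X *m X) + (be * be)%:M).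
  by apply/eqP; rewrite -addr_eq0 addrA; apply/eqP.
have -> : (1 - s) * (1 - s) = v * v * v * v * (be * be) by rewrite /s; ring.
have c2 : -2 * (1 + s) * (v * v) = v * v * v * v * a.
  transitivity (v * v * v * v * a - 4 * v * v * (1 - (u * v) * (u * v))).
    by rewrite aE /s; ring.
  by rewrite uv; ring.
by rewrite scalerN scalerDr !scalerA c2 scale_scalar_mx -addrA addNr.
Qed.

Lemma normal_form (K : numFieldType) (X L : 'M[fps K]_4) :
  L^T = L -> X *m L = - (L *m X^T) ->
  map_mx (@fps_coef0 K) X = dmx 0 -> map_mx (@fps_coef0 K) L = lmx 0 ->
  exists u v s W, [/\ u * v = 1 /\ fps_coef0 u = 1, fps_coef0 s = 0,
    map_mx (@fps_coef0 K) W = 1%:M,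
    W *m X = u *: (dmx s *m W) & W *m L *m W^T = lmx s].
Proof.
move=> Lsym XL X0 L0.
have [f f0] : exists f, map_mx (@fps_coef0 K) f = rv4 [:: 0; 1; 1; 0].
  by exists (rv4 [:: 0; 1; 1; 0]); rewrite map_rv4 /= ?rmorph0 ?rmorph1.
have [a [b [a0 b0 ab0]]] := quartic XL X0 L0 f0; clear f f0.
have [be bebe be0] := fps_sqrt b0.
have h2 : fps_const 2^-1 * 2%:R = 1 :> fps K.
  by rewrite -(rmorph_nat (@fps_const K) 2) -rmorphM mulVf ?rmorph1 //.
have h0 : fps_coef0 (fps_const 2^-1) = 2^-1 :> K by [].
move: (fps_const 2^-1) h2 h0 => h h2 h0.
(* As h = 1/2, this series is (2 be - a) / 4, the value required of u^2; at t = 0 it is (2 + 2) /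
   4. *)
have w1 : fps_coef0 (h * (be - h * a)) = 1.
  by rewrite fps_coef0M fps_coef0B fps_coef0M a0 be0 h0; field.
have [u uu u0] := fps_sqrt w1.
have [|v uv] := @fps_inverse K u; first by rewrite u0 oner_eq0.
have v0 : fps_coef0 v = 1.
  by rewrite -[LHS]mul1r -{1}u0 -fps_coef0M uv.
have aE : a = 2 * be - 4 * (u * u).
  rewrite uu; transitivity ((h * 2) * (h * 2) * a + 2 * be * (1 - h * 2)).
    by rewrite h2; ring.
  by ring.
have fg0 := @rescaled_quartic _ X a be u v; rewrite bebe in fg0.
have {aE ab0} fg0 := fg0 ab0 aE uv.
pose s := 1 - be * v * v; rewrite -/s in fg0.
have s0 : fps_coef0 s = 0.
  by rewrite /s fps_coef0B !fps_coef0M be0 v0 !mulr1; exact: subrr.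
set Y := v *: X in fg0.
have YL : Y *m L = - (L *m Y^T).
  by rewrite /Y -scalemxAl XL linearZ /= -scalemxAr scalerN.
have Y0 : map_mx (@fps_coef0 K) Y = dmx 0 by rewrite redZ v0 scale1r.
have XY : X = u *: Y by rewrite /Y scalerA uv scale1r.
clearbody s Y; clear X0 XL.
have step (w : 'rV[fps K]_4) a1 a2 a3 a4 :
    map_mx (@fps_coef0 K) w = rv4 [:: a1; a2; a3; a4] ->
    map_mx (@fps_coef0 K) (w *m Y) =
    rv4 [:: a1 + a2; 0 * a1 + a2; - a3 - 0 * a4; - a3 - a4].
  by move=> w0; rewrite red_mulmx w0 Y0 mul_rv4_dmx.
(* At t = 0, (Y + 1)^2 acts on the block of 1 as 4 (1 + N), where N sends e_4 to e_3 and e_3 to 0.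
   So the seed (e_4 - e_3) / 4 is projected to e_4, and likewise (e_5 - e_6) / 4 to e_5 by (Y -
   1)^2. *)
pose q : fps K := fps_const 4^-1.
pose z : 'rV[fps K]_4 := rv4 [:: - q; q; 0; 0].
pose z' : 'rV[fps K]_4 := rv4 [:: 0; 0; q; - q].
have z0 : map_mx (@fps_coef0 K) z = rv4 [:: - 4^-1; 4^-1; 0; 0].
  by rewrite map_rv4 //= rmorphN rmorph0.
have z'0 : map_mx (@fps_coef0 K) z' = rv4 [:: 0; 0; 4^-1; - 4^-1].
  by rewrite map_rv4 //= rmorphN rmorph0.
clearbody z z'.
have rvD a1 a2 a3 a4 b1 b2 b3 b4 : rv4 [:: a1; a2; a3; a4] + rv4 [:: b1; b2; b3; b4]
    = rv4 [:: a1 + b1; a2 + b2; a3 + b3; a4 + b4] :> 'rV[K]_4.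
  by apply/rowP => -[[|[|[|[|//]]]] ?]; rewrite !mxE.
have rvZ k a1 a2 a3 a4 : k *: rv4 [:: a1; a2; a3; a4]
    = rv4 [:: k * a1; k * a2; k * a3; k * a4] :> 'rV[K]_4.
  by apply/rowP => -[[|[|[|[|//]]]] ?]; rewrite !mxE.
have s1 : fps_coef0 (1 - s) = 1 by rewrite fps_coef0B s0 subr0.
have two : fps_coef0 (2 : fps K) = 2 by rewrite rmorph_nat.
have Ntwo : fps_coef0 (-2 : fps K) = -2 by rewrite rmorphN rmorph_nat.
have b4 : map_mx (@fps_coef0 K) (basis4 Y s z) = rv4 [:: 0; 1; 0; 0].
  rewrite /basis4 mul_gpoly redD redD redZ redZ s1 two.
  rewrite (step _ _ _ _ _ (step _ _ _ _ _ z0)) (step _ _ _ _ _ z0) z0.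
  by rewrite !rvZ !rvD; apply: eq_rv4; field.
have b5 : map_mx (@fps_coef0 K) (basis5 Y s z') = rv4 [:: 0; 0; 1; 0].
  rewrite /basis5 mul_fpoly redD redD redZ redZ s1 Ntwo.
  rewrite (step _ _ _ _ _ (step _ _ _ _ _ z'0)) (step _ _ _ _ _ z'0) z'0.
  by rewrite !rvZ !rvD; apply: eq_rv4; field.
have b3 : map_mx (@fps_coef0 K) (basis3 Y s z) = rv4 [:: 1; 0; 0; 0].
  rewrite -[basis3 Y s z](addrK (basis4 Y s z)) -basis4Y redD redN.
  rewrite (step _ _ _ _ _ b4) b4 -scaleN1r rvZ rvD; apply: eq_rv4; ring.
have b6 : map_mx (@fps_coef0 K) (basis6 Y s z') = rv4 [:: 0; 0; 0; 1].
  have -> : basis6 Y s z' = - (basis5 Y s z' *m Y + basis5 Y s z').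
    by rewrite opprD.
  rewrite redN redD (step _ _ _ _ _ b5) b5 rvD -scaleN1r rvZ.
  by apply: eq_rv4; ring.
pose al := (basis4 Y s z *m L *m (basis6 Y s z')^T) 0 0.
pose ga := (basis4 Y s z *m L *m (basis5 Y s z')^T) 0 0.
have pair0 (v1 w1' : 'rV[fps K]_4) a1 a2 a3 a4 a5 a6 a7 a8 :
    map_mx (@fps_coef0 K) v1 = rv4 [:: a1; a2; a3; a4] ->
    map_mx (@fps_coef0 K) w1' = rv4 [:: a5; a6; a7; a8] ->
    fps_coef0 ((v1 *m L *m w1'^T) 0 0) =
    a1 * a7 + a2 * a7 + a2 * a8 + a3 * a5 + a3 * a6 + a4 * a6.
  by move=> v10 w10; rewrite red_pair L0 v10 w10 rv4_lmx0.
have al0 : fps_coef0 al = 1 by rewrite (pair0 _ _ _ _ _ _ _ _ _ _ b4 b6); ring.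
have ga0 : fps_coef0 ga = 1 by rewrite (pair0 _ _ _ _ _ _ _ _ _ _ b4 b5); ring.
have [alE gaE] : al = (basis4 Y s z *m L *m (basis6 Y s z')^T) 0 0 /\
  ga = (basis4 Y s z *m L *m (basis5 Y s z')^T) 0 0 by [].
clearbody al ga.
(* The determinant of the two linear equations of [jordan_basis_pair], which p and r solve by
   Cramer's rule. The values al = ga = 1 and s = 0 at t = 0 give p = 1 and r = 0 there, so the new
   basis reduces to the identity. *)
have delta0 : fps_coef0 (al * al - s * (ga * ga)) = 1.
  by rewrite fps_coef0B !fps_coef0M al0 ga0 s0; ring.
have [|d dE] := @fps_inverse K (al * al - s * (ga * ga)).
  by rewrite delta0 oner_eq0.
have d0 : fps_coef0 d = 1.
  by rewrite -[LHS]mul1r -{1}delta0 -fps_coef0M dE.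
pose p := (al - s * ga) * d; pose r := (al - ga) * d.
have p0 : fps_coef0 p = 1 by rewrite fps_coef0M fps_coef0B fps_coef0M al0 s0 d0; ring.
have r0 : fps_coef0 r = 0 by rewrite fps_coef0M fps_coef0B al0 ga0 subrr mul0r.
exists u, v, s, (jordan_basis Y s z z' p r); split=> //.
- rewrite /jordan_basis; clear alE gaE.
  move: (basis3 Y s z) (basis4 Y s z) (basis5 Y s z') (basis6 Y s z') b3 b4 b5 b6.
  move=> w3 w4 w5 w6 b3 b4 b5 b6; apply/row_matrixP => i.
  rewrite -map_row rowK row1.
  case: i => [[|[|[|[|//]]]] ?] /=; rewrite ?b3 ?b4 ?redD ?redZ ?b5 ?b6 ?p0 ?r0
    ?fps_coef0M ?r0 ?s0 ?rvZ ?rvD;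
    apply/rowP => -[[|[|[|[|//]]]] ?]; rewrite !mxE /=; ring.
- by rewrite XY -scalemxAr jordan_basis_mul.
- have al1 : p * al + r * s * ga = 1 by rewrite -dE /p /r; ring.
  have ga1 : p * ga + r * al = 1 by rewrite -dE /p /r; ring.
  by rewrite alE gaE in al1 ga1; exact: (jordan_basis_pair Lsym YL fg0 al1 ga1).
Qed.

(** * Metric structures on deformations *)

Section LinearMaps.
Variables (K : comNzRingType) (U V : lmodType K) (f : U -> V).
Hypothesis lf : linear f.

Lemma linear_mapD x y : f (x + y) = f x + f y.
Proof. by have := lf 1 x y; rewrite !scale1r. Qed.

Lemma linear_map0 : f 0 = 0.
Proof. by have := lf (-1) 0 0; rewrite !scaleN1r !addNr. Qed.

Lemma linear_mapZ a x : f (a *: x) = a *: f x.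
Proof. by have := lf a x 0; rewrite !addr0 linear_map0 addr0. Qed.

End LinearMaps.

Lemma linear_row_mx (K : comNzRingType) n p (f : 'rV[K]_n -> 'rV[K]_p) :
  linear f -> forall x, f x = x *m \matrix_i f (delta_mx 0 i).
Proof.
move=> lf x; rewrite (linear_sum_delta lf) mulmx_sum_row.
by apply: eq_bigr => i _; rewrite rowK.
Qed.

Lemma bilinear_form_mx (K : comNzRingType) n (f : 'rV[K]_n -> 'rV[K]_n -> K) :
  (forall y, scalar (f^~ y)) -> (forall x, scalar (f x)) ->
  forall x y, f x y =
    (x *m (\matrix_(i, j) f (delta_mx 0 i) (delta_mx 0 j)) *m y^T) 0 0.
Proof.
move=> fl fr x y; have fl' z : linear (f^~ z : _ -> K^o) by exact: fl.
have fr' z : linear (f z : _ -> K^o) by exact: fr.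
rewrite (linear_sum_delta (fl' y)) -mulmxA mxE; apply: eq_bigr => i _.
rewrite (linear_sum_delta (fr' _)) mxE; congr (_ * _); apply: eq_bigr => j _.
by rewrite !mxE [LHS]mulrC.
Qed.

(** The deformation condition speaks of constant vectors; bilinearity over K[[t]] extends it to all
    vectors. *)
Lemma red_bracket (K : comNzRingType) m n
    (b0 : 'rV[K]_(m + n) -> 'rV[K]_(m + n) -> 'rV[K]_(m + n)) b :
  (forall y, linear (b0^~ y)) -> (forall x, linear (b0 x)) ->
  (forall y, linear (b^~ y)) -> (forall x, linear (b x)) ->
  (forall x y, coefv 0 (b (constv x) (constv y)) = b0 x y) ->
  forall x y, map_mx (@fps_coef0 K) (b x y) =
    b0 (map_mx (@fps_coef0 K) x) (map_mx (@fps_coef0 K) y).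
Proof.
move=> b0l b0r bl br red0 x y.
rewrite (eq_bilinear_extension bl br) (eq_bilinear_extension b0l b0r).
rewrite /bilinear_extension map_mx_sum; apply: eq_bigr => i _.
rewrite map_mx_sum; apply: eq_bigr => j _.
rewrite redZ fps_coef0M !mxE; congr (_ *: _); rewrite -red0.
have delta k : constv (delta_mx 0 k) = delta_mx 0 k :> 'rV[fps K]_(m + n).
  by apply/rowP => l; rewrite !mxE; case: (_ && _); rewrite ?rmorph0 ?rmorph1.
by rewrite !delta.
Qed.

Definition even_part (K : comNzRingType) m n (u : 'rV[K]_m) : 'rV[K]_(m + n) :=
  row_mx u 0.
Definition odd_part (K : comNzRingType) m n (v : 'rV[K]_n) : 'rV[K]_(m + n) :=
  row_mx 0 v.

Section Parts.
Variables (K : comNzRingType) (m n : nat).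
Implicit Types (u : 'rV[K]_m) (v : 'rV[K]_n).
Local Notation iE := (@even_part K m n).
Local Notation iO := (@odd_part K m n).

Lemma homogeneous_even_part u : homogeneous false (iE u).
Proof. by apply/homogeneous_even; rewrite row_mxKr. Qed.

Lemma homogeneous_odd_part v : homogeneous true (iO v).
Proof. by apply/homogeneous_odd; rewrite row_mxKl. Qed.

Lemma even_part_homogeneous x : homogeneous false x -> x = iE (lsubmx x).
Proof. by move/homogeneous_even => x0; rewrite -[LHS]hsubmxK x0. Qed.

Lemma odd_part_homogeneous x : homogeneous true x -> x = iO (rsubmx x).
Proof. by move/homogeneous_odd => x0; rewrite -[LHS]hsubmxK x0. Qed.

Lemma parts_sum x : x = iE (lsubmx x) + iO (rsubmx x).
Proof. by rewrite /even_part /odd_part add_row_mx addr0 add0r hsubmxK. Qed.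

Lemma even_part_linear : linear iE.
Proof.
by move=> a u u'; rewrite /even_part scale_row_mx add_row_mx scaler0 addr0.
Qed.

Lemma odd_part_linear : linear iO.
Proof.
by move=> a u u'; rewrite /odd_part scale_row_mx add_row_mx scaler0 addr0.
Qed.

Lemma odd_part_inj : injective iO.
Proof. by move=> v v' /eq_row_mx[]. Qed.

End Parts.

Lemma red_even_part (K : comNzRingType) m n (u : 'rV[fps K]_m) :
  map_mx (@fps_coef0 K) (even_part n u) = even_part n (map_mx (@fps_coef0 K) u).
Proof. by rewrite /even_part map_row_mx map_mx0. Qed.

Lemma red_odd_part (K : comNzRingType) m n (v : 'rV[fps K]_n) :
  map_mx (@fps_coef0 K) (odd_part m v) = odd_part m (map_mx (@fps_coef0 K) v).
Proof. by rewrite /odd_part map_row_mx map_mx0. Qed.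

Lemma red_delta (K : comNzRingType) m n i j :
  map_mx (@fps_coef0 K) (delta_mx i j : 'M[fps K]_(m, n)) = delta_mx i j.
Proof. exact: map_delta_mx. Qed.

Lemma row2_sum (K : comNzRingType) (u : 'rV[K]_2) :
  u = u 0 0 *: delta_mx 0 0 + u 0 1 *: delta_mx 0 1.
Proof.
rewrite {1}[u]row_sum_delta !big_ord_recl big_ord0 addr0.
by have -> : lift ord0 ord0 = 1 :> 'I_2 by apply: val_inj.
Qed.

Definition rows2 (K : nzRingType) n (w0 w1 : 'rV[K]_n) : 'M[K]_(2, n) :=
  \matrix_(i < 2) if i == 0 then w0 else w1.

Lemma mul_rows2 (K : comNzRingType) n (p : 'rV[K]_2) (w0 w1 : 'rV[K]_n) :
  p *m rows2 w0 w1 = p 0 0 *: w0 + p 0 1 *: w1.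
Proof.
rewrite mulmx_sum_row !big_ord_recl big_ord0 addr0 !rowK /=.
by have -> : lift ord0 ord0 = 1 :> 'I_2 by apply: val_inj.
Qed.

(** The vector [e_1, e_2] is orthogonal to e_1 and e_2 by invariance, since [e_1, e_1] = [e_2, e_2]
    = 0, and to the odd part by parity. Non-degeneracy makes it 0. *)
Lemma even_bracket0 (K : comNzRingType) n
    (b : 'rV[K]_(2 + n) -> 'rV[K]_(2 + n) -> 'rV[K]_(2 + n)) B :
  (forall x : K, x = - x -> x = 0) ->
  is_lie_superalgebra b -> is_metric_form b B ->
  forall u v, b (even_part n u) (even_part n v) = 0.
Proof.
move=> no2 lieb metB.
have bl := lie_linear_l lieb; have br := lie_linear_r lieb.
have Br x : linear (B x : _ -> K^o) by exact: form_linear_r metB x.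
have Bl y : linear (B^~ y : _ -> K^o) by exact: form_linear_l metB y.
pose iE := @even_part K 2 n.
have hE u : homogeneous false (iE u) by exact: homogeneous_even_part.
have skew u v : b (iE u) (iE v) = - b (iE v) (iE u).
  by rewrite (lie_skew lieb (hE v) (hE u)) expr0 scale1r.
have alt u : b (iE u) (iE u) = 0.
  apply/rowP => k; rewrite mxE; apply: no2.
  by rewrite {1}skew mxE.
pose d (i : 'I_2) : 'rV[K]_2 := delta_mx 0 i.
have b01 : b (iE (d 0)) (iE (d 1)) = 0.
  have hz := lie_even lieb (hE (d 0)) (hE (d 1)).
  (* Uniqueness for the zero functional: a vector orthogonal to everything is 0. *)
  have [x [_ xuniq]] := form_nondegenerate metB (f := fun=> 0)
    (fun a x y => esym (etrans (addr0 _) (mulr0 _))).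
  transitivity x; last first.
    by apply: xuniq => y; exact: (linear_map0 (Bl y)).
  symmetry; apply: xuniq => y; rewrite (parts_sum y) (linear_mapD (Br _)).
  rewrite (form_even metB hz (@homogeneous_odd_part _ _ _ (rsubmx y))) // addr0.
  rewrite (row2_sum (lsubmx y)) (linear_mapD (@even_part_linear _ _ _)).
  rewrite !(linear_mapZ (@even_part_linear _ _ _)) (linear_mapD (Br _)).
  rewrite !(linear_mapZ (Br _)) -!/(iE _) -!/(d _).
  have -> : B (b (iE (d 0)) (iE (d 1))) (iE (d 1)) = 0.
    by rewrite (form_invariant metB) alt (linear_map0 (Br _)).
  have -> : B (b (iE (d 0)) (iE (d 1))) (iE (d 0)) = 0.
    rewrite skew -scaleN1r (linear_mapZ (Bl _)) (form_invariant metB) alt.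
    by rewrite (linear_map0 (Br _)) scaler0.
  by rewrite !scaler0 addr0.
move=> u v; rewrite (row2_sum u) (row2_sum v).
rewrite !(linear_mapD (@even_part_linear _ _ _)).
rewrite !(linear_mapZ (@even_part_linear _ _ _)).
rewrite (linear_mapD (bl _)) !(linear_mapD (br _)) !(linear_mapZ (bl _)).
rewrite !(linear_mapZ (br _)) -!/(iE _) -!/(d _) !alt b01 skew b01.
by rewrite oppr0 !scaler0 !addr0.
Qed.

Lemma dmx0_unit (K : comNzRingType) : exists M, dmx (0 : K) *m M = 1%:M.
Proof.
exists (mx4 [:: [:: 1; 0; 0; 0]; [:: -1; 1; 0; 0]; [:: 0; 0; -1; 1];
                [:: 0; 0; 0; -1]]).
apply/matrixP => -[[|[|[|[|//]]]] ?] [[|[|[|[|//]]]] ?];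
  rewrite !mxE !big_ord_recl big_ord0 !mxE /=; ring.
Qed.

(** The Jacobi identity of v, v, v reads 3 [[v, v], v] = 0. *)
Lemma odd_cube0 (K : comNzRingType) m n
    (b : 'rV[K]_(m + n) -> 'rV[K]_(m + n) -> 'rV[K]_(m + n)) v :
  (forall x : K, x *+ 3 = 0 -> x = 0) -> is_lie_superalgebra b ->
  homogeneous true v -> b (b v v) v = 0.
Proof.
move=> no3 lieb hv; have hvv := lie_even lieb hv hv.
have := lie_jacobi lieb hv hv hv.
rewrite /= expr1 scaleN1r (lie_skew lieb hvv hv) /= expr0 scale1r.
move: (b (b v v) v) => t tE; apply/rowP => k; rewrite mxE; apply: no3.
move/rowP/(_ k): tE; rewrite !mxE opprK => tE.
by rewrite !mulrS addr0 -tE addrN.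
Qed.

Section Structure.
Variable A : comNzRingType.
Variables (b : 'rV[A]_(2 + 4) -> 'rV[A]_(2 + 4) -> 'rV[A]_(2 + 4)).
Variable B : 'rV[A]_(2 + 4) -> 'rV[A]_(2 + 4) -> A.
Hypothesis lieb : is_lie_superalgebra b.
Hypothesis metB : is_metric_form b B.
Hypothesis no_torsion : forall n (x : A), x *+ n.+1 = 0 -> x = 0.
Local Notation iE := (@even_part A 2 4).
Local Notation iO := (@odd_part A 2 4).

Let bl := lie_linear_l lieb.
Let br := lie_linear_r lieb.
Let hE u : homogeneous false (iE u). Proof. exact: homogeneous_even_part. Qed.
Let hO v : homogeneous true (iO v). Proof. exact: homogeneous_odd_part. Qed.
Let EL : linear iE. Proof. exact: even_part_linear. Qed.
Let OL : linear iO. Proof. exact: odd_part_linear. Qed.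

(** Indices 0 and 1 stand for e_1 and e_2. Both are kept because after deformation e_1 may act on
    the odd part, and odd brackets may have an e_2-component. *)
Definition ad_odd (i : 'I_2) : 'M[A]_4 :=
  \matrix_j rsubmx (b (iE (delta_mx 0 i)) (iO (delta_mx 0 j))).

Definition odd_square (k : 'I_2) : 'M[A]_4 :=
  \matrix_(i, j) lsubmx (b (iO (delta_mx 0 i)) (iO (delta_mx 0 j))) 0 k.

Lemma bracket_delta_odd i w :
  b (iE (delta_mx 0 i)) (iO w) = iO (w *m ad_odd i).
Proof.
rewrite [LHS]odd_part_homogeneous; last first.
  by have := lie_even lieb (hE (delta_mx 0 i)) (hO w).
congr iO.
apply: (linear_row_mx (f := fun w => rsubmx (b (iE (delta_mx 0 i)) (iO w)))).
by move=> a x y /=; rewrite OL br linearP.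
Qed.

Lemma bracket_even_odd u v : b (iE u) (iO v) =
  iO (v *m (u 0 0 *: ad_odd 0 + u 0 1 *: ad_odd 1)).
Proof.
rewrite {1}(row2_sum u) (linear_mapD EL) !(linear_mapZ EL) (linear_mapD (bl _)).
rewrite !(linear_mapZ (bl _)) !bracket_delta_odd mulmxDr -!scalemxAr.
by rewrite (linear_mapD OL) !(linear_mapZ OL).
Qed.

Lemma bracket_even_even u v : b (iE u) (iE v) = 0.
Proof.
apply: even_bracket0 lieb metB u v => x xN; apply: (@no_torsion 1).
by rewrite mulr2n {1}xN addNr.
Qed.

Lemma ad_oddC : ad_odd 0 *m ad_odd 1 = ad_odd 1 *m ad_odd 0.
Proof.
apply/row_matrixP => i; rewrite !rowE !mulmxA; apply: (@odd_part_inj _ 2).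
have := lie_jacobi lieb (hE (delta_mx 0 1)) (hE (delta_mx 0 0)) (hO (delta_mx 0 i)).
by rewrite bracket_even_even (linear_map0 (bl _)) add0r expr0 scale1r
  !bracket_delta_odd.
Qed.

Lemma bracket_odd_odd v w : b (iO v) (iO w) = iE (lsubmx (b (iO v) (iO w))).
Proof. by apply: even_part_homogeneous; have := lie_even lieb (hO v) (hO w). Qed.

Lemma odd_squareE k v w :
  lsubmx (b (iO v) (iO w)) 0 k = (v *m odd_square k *m w^T) 0 0.
Proof.
apply: (bilinear_form_mx (f := fun v w => lsubmx (b (iO v) (iO w)) 0 k)).
  by move=> y c x x'; rewrite OL bl linearP !mxE.
by move=> x c y y'; rewrite OL br linearP !mxE.
Qed.

Lemma tr_odd_square k : (odd_square k)^T = odd_square k.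
Proof.
apply/matrixP => i j; rewrite !mxE (lie_skew lieb (hO (delta_mx 0 i)) (hO _)).
by rewrite /= expr1 scaleN1r opprK.
Qed.

Let entryD (M N : 'M[A]_1) : (M + N) 0 0 = M 0 0 + N 0 0.
Proof. exact: mxE. Qed.
Let entryN (M : 'M[A]_1) : (- M) 0 0 = - M 0 0. Proof. exact: mxE. Qed.
Let entryZ a (M : 'M[A]_1) : (a *: M) 0 0 = a * M 0 0. Proof. exact: mxE. Qed.

Let delta_form (M : 'M[A]_4) i j :
  (@delta_mx A 1 4 0 i *m M *m (@delta_mx A 1 4 0 j)^T) 0 0 = M i j.
Proof. by rewrite trmx_delta -rowE -colE !mxE. Qed.

(** The bracket of e_2 with the even vector [x, y] is 0, so the Jacobi identity makes ad e_2 skew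
    for each component of the odd bracket. *)
Lemma mul_odd_square k : ad_odd 1 *m odd_square k = - (odd_square k *m (ad_odd 1)^T).
Proof.
apply/eqP; rewrite -addr_eq0; apply/eqP/matrixP => i j.
have := lie_jacobi lieb (hE (delta_mx 0 1)) (hO (delta_mx 0 i)) (hO (delta_mx 0 j)).
rewrite bracket_odd_odd bracket_even_even expr0 scale1r !bracket_delta_odd.
move/(congr1 (fun x => lsubmx x 0 k)); rewrite linearD /= [RHS]mxE !odd_squareE.
have -> : lsubmx (0 : 'rV[A]_(2 + 4)) 0 k = 0 by rewrite !mxE.
move=> jac; rewrite [RHS]mxE [LHS]mxE jac; congr (_ + _).
  by rewrite -(mulmxA _ (ad_odd 1)) delta_form.
by rewrite trmx_mul !mulmxA -(mulmxA (delta_mx 0 i)) delta_form.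
Qed.

Variables (f : 'rV[A]_4) (h d : A) (C' X' : 'M[A]_4).
Definition central_vector : 'rV[A]_2 := h *: lsubmx (b (iO f) (iO f)).
Hypothesis f_cyclic : C' *m krylov_mx (ad_odd 1) f = 1%:M.
Hypothesis ad_unit : ad_odd 1 *m X' = 1%:M.
Hypothesis dE : central_vector 0 0 * d = 1.

(* A square [f, f] commutes with f by the Jacobi identity, hence with the whole
   odd part, which f generates under ad e_2. *)
Lemma central_vector_odd v : b (iE central_vector) (iO v) = 0.
Proof.
rewrite bracket_even_odd; set P := _ + _.
suff -> : P = 0 by rewrite mulmx0 (linear_map0 OL).
apply: (cyclic_kernel f_cyclic).
  by rewrite mulmxDl mulmxDr -!scalemxAl -!scalemxAr ad_oddC.
apply: (@odd_part_inj _ 2); rewrite -bracket_even_odd (linear_mapZ EL).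
rewrite -bracket_odd_odd (linear_mapZ (bl _)) odd_cube0 ?scaler0 ?(linear_map0 OL) //.
by move=> x; exact: no_torsion.
Qed.

Let c := central_vector 0 1.

Lemma ad_odd0E : ad_odd 0 = - (d * c) *: ad_odd 1.
Proof.
have E0 : central_vector 0 0 *: ad_odd 0 + c *: ad_odd 1 = 0.
  apply/row_matrixP => i; rewrite rowE row0; apply: (@odd_part_inj _ 2).
  by rewrite -bracket_even_odd central_vector_odd (linear_map0 OL).
rewrite -[LHS]scale1r -dE mulrC -scalerA.
have -> : central_vector 0 0 *: ad_odd 0 = - (c *: ad_odd 1).
  by apply/eqP; rewrite -addr_eq0 E0.
by rewrite scalerN scaleNr scalerA.
Qed.

(* Modulo the central vector, [v, v] = tau e_2 for some tau, and [[v, v], v] = 0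
   gives tau v = 0 because ad e_2 is invertible. *)
Lemma odd_square1 : odd_square 1 = (d * c) *: odd_square 0.
Proof.
pose T := odd_square 1 - (d * c) *: odd_square 0.
have TE (v : 'rV[A]_4) : (v *m T *m v^T) 0 0 *: v = 0.
  set tau := (_ *m v^T) 0 0; suff t0 : v *m (tau *: ad_odd 1) = 0.
    by rewrite -[v]mulmx1 -ad_unit mulmxA scalemxAl scalemxAr t0 mul0mx.
  apply: (@odd_part_inj _ 2); rewrite (linear_map0 OL).
  have := odd_cube0 (fun x => @no_torsion 2 x) lieb (hO v).
  rewrite bracket_odd_odd bracket_even_odd !odd_squareE ad_odd0E => <-.
  congr (iO (v *m _)); rewrite scalerA -scalerDl; congr (_ *: _).
  by rewrite /tau /T mulmxBr mulmxBl -scalemxAr -scalemxAl entryD entryN entryZ; ring.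
have TT : T^T = T by rewrite /T linearB linearZ /= !tr_odd_square.
have Tsym i j : T i j = T j i by rewrite -{1}TT mxE.
(* [TE] gives tau = 0 for every v that has a coordinate equal to 1. Basis vectors give the diagonal
   of T, and their sums give twice the other entries by polarisation. *)
have Tii i : T i i = 0.
  have := TE (delta_mx 0 i); rewrite delta_form => /rowP/(_ i).
  by rewrite [LHS]mxE [RHS]mxE [X in _ * X]mxE !eqxx mulr1.
suff T0 : T = 0 by apply/eqP; rewrite -subr_eq0 -/T T0.
clearbody T; apply/matrixP => i j; rewrite [RHS]mxE; case: (altP (i =P j)) => [->//|ij].
apply: (@no_torsion 1); pose di := @delta_mx A 1 4 0 i; pose dj := @delta_mx A 1 4 0 j.
have -> : T i j *+ 2 = ((di + dj) *m T *m (di + dj)^T) 0 0.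
  have -> : (di + dj)^T = di^T + dj^T by exact: linearD.
  rewrite !mulmxDl !mulmxDr !entryD /di /dj !delta_form !Tii.
  by rewrite (Tsym j i) add0r addr0 mulr2n.
have /rowP/(_ i) := TE (di + dj); rewrite [LHS]mxE [RHS]mxE [X in _ * X]mxE.
rewrite [X in _ * (X + _)]mxE [X in _ * (_ + X)]mxE !eqxx (negbTE ij) andbF.
by rewrite addr0 mulr1.
Qed.

(** By [odd_square1] the odd brackets are multiples of e_1 + (d c) e_2, which is d times the central
    vector. *)
Lemma metric_structure v w : b (iO v) (iO w) =
  (v *m (d *: odd_square 0) *m w^T) 0 0 *: iE central_vector.
Proof.
rewrite bracket_odd_odd -(linear_mapZ EL); congr iE.
rewrite [LHS]row2_sum [RHS]row2_sum !odd_squareE odd_square1.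
have cvE a k : (a *: central_vector) 0 k = a * central_vector 0 k by rewrite mxE.
rewrite !cvE -!scalemxAr -!scalemxAl !entryZ.
congr (_ *: _ + _ *: _); last by rewrite /c; ring.
by rewrite -[LHS]mul1r -dE; ring.
Qed.

End Structure.

(** The new basis consists of [cv], of v e_2 and of the rows of [W]; as v = 1/u, rescaling e_2
    cancels the factor u in the normal form of [X]. *)
Lemma versal_bracket_morphism (A : comNzRingType)
    (b : 'rV[A]_(2 + 4) -> 'rV[A]_(2 + 4) -> 'rV[A]_(2 + 4))
    (cv : 'rV[A]_2) (X L W : 'M[A]_4) (u v s : A) :
  is_lie_superalgebra b ->
  (forall x y, b (even_part 4 x) (even_part 4 y) = 0) ->
  (forall x, b (even_part 4 cv) (odd_part 2 x) = 0) ->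
  (forall x, b (even_part 4 (delta_mx 0 1)) (odd_part 2 x) = odd_part 2 (x *m X)) ->
  (forall x y, b (odd_part 2 x) (odd_part 2 y) =
     (x *m L *m y^T) 0 0 *: even_part 4 cv) ->
  u * v = 1 -> W *m X = u *: (dmx s *m W) -> W *m L *m W^T = lmx s ->
  let M := block_mx (rows2 cv (v *: delta_mx 0 1)) 0 0 W in
  forall x y, b (x *m M) (y *m M) = versal_bracket s x y *m M.
Proof.
move=> lieb bEE bcv bX bOO uv WX WL M x y.
have bl := lie_linear_l lieb; have br := lie_linear_r lieb.
have EL := @even_part_linear A 2 4; have OL := @odd_part_linear A 2 4.
have zM z : z *m M = even_part 4 (lsubmx z *m rows2 cv (v *: delta_mx 0 1)) +
                     odd_part 2 (rsubmx z *m W).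
  rewrite -{1}(hsubmxK z) mul_row_block !mulmx0 addr0 add0r.
  by rewrite /even_part /odd_part add_row_mx addr0 add0r.
have eo (p : 'rV[A]_2) w :
    b (even_part 4 (p *m rows2 cv (v *: delta_mx 0 1))) (odd_part 2 (w *m W)) =
    odd_part 2 (p 0 1 *: (w *m dmx s *m W)).
  rewrite mul_rows2 (linear_mapD EL) !(linear_mapZ EL) (linear_mapD (bl _)).
  rewrite !(linear_mapZ (bl _)) bcv scaler0 add0r bX -!(linear_mapZ OL).
  rewrite -mulmxA WX -scalemxAr !scalerA mulmxA; congr (odd_part 2 (_ *: _)).
  by rewrite -mulrA (mulrC v) uv mulr1.
have oe p w : b (odd_part 2 w) (even_part 4 p) = - b (even_part 4 p) (odd_part 2 w).
  by rewrite (lie_skew lieb (homogeneous_even_part _) (homogeneous_odd_part _))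
    expr0 scale1r.
rewrite !zM (linear_mapD (bl _)) !(linear_mapD (br _)) bEE add0r oe !eo bOO.
rewrite addrA addrC lsubmx_dext rsubmx_dext.
have -> : rsubmx x *m W *m L *m (rsubmx y *m W)^T = rsubmx x *m lmx s *m (rsubmx y)^T.
  by rewrite trmx_mul -WL !mulmxA.
rewrite -scalemxAl (linear_mapZ EL); congr (_ *: _ + _).
  by congr (even_part 4 _); rewrite mul_rows2 !mxE /= scale1r scale0r addr0.
rewrite -scaleN1r -(linear_mapZ OL) -(linear_mapD OL) scaleN1r.
by rewrite mulmxBl -!scalemxAl.
Qed.

Section ReducedStructure.
Variable K : comNzRingType.
Local Notation A := (fps K).
Local Notation red := (map_mx (@fps_coef0 K)).
Variables (b : 'rV[A]_(2 + 4) -> 'rV[A]_(2 + 4) -> 'rV[A]_(2 + 4)).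
Hypothesis red_b : forall x y, red (b x y) = versal_bracket 0 (red x) (red y).

Lemma red_ad_odd1 : red (ad_odd b 1) = dmx 0.
Proof.
apply/row_matrixP => j; rewrite -map_row rowK map_rsubmx red_b.
rewrite red_even_part red_odd_part !red_delta rsubmx_dext.
rewrite !row_mxKl !row_mxKr mul0mx scaler0 subr0 -rowE mxE eqxx /=.
exact: scale1r.
Qed.

Lemma red_odd_square0 : red (odd_square b 0) = lmx 0.
Proof.
apply/matrixP => i j; rewrite mxE [odd_square b 0 i j]mxE.
have -> (x : 'rV[A]_(2 + 4)) : fps_coef0 (lsubmx x 0 0) = lsubmx (red x) 0 0.
  by rewrite !mxE.
rewrite red_b !red_odd_part !red_delta lsubmx_dext !row_mxKr.
by rewrite trmx_delta -rowE -colE !mxE mulr1.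
Qed.

(** In the undeformed algebra [e_4 + e_5, e_4 + e_5] = 2 [e_4, e_5] = 2 e_1. So the central vector
    deforms e_1, and its e_1-coordinate is a unit. *)
Lemma red_central_vector f h : red f = rv4 [:: 0; 1; 1; 0] ->
  fps_coef0 h * 2 = 1 -> red (central_vector b f h) = delta_mx 0 0.
Proof.
move=> f0 h2; rewrite redZ map_lsubmx red_b !red_odd_part lsubmx_dext.
rewrite !row_mxKr f0 rv4_lmx0 scalerA.
transitivity ((fps_coef0 h * 2) *: (delta_mx 0 0 : 'rV[K]_2)).
  by congr (_ *: _); ring.
by rewrite h2 scale1r.
Qed.

End ReducedStructure.

Lemma red_inverse (K : fieldType) n (M : 'M[fps K]_n) :
  map_mx (@fps_coef0 K) M = 1%:M ->
  exists N, [/\ M *m N = 1%:M, N *m M = 1%:M & map_mx (@fps_coef0 K) N = 1%:M].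
Proof.
move=> M0; have [|N MN NM] := @mx_inverse_mod_t K n M.
  by rewrite M0 det1 oner_eq0.
exists N; split=> //; rewrite -[LHS]mul1mx -{1}M0 -red_mulmx MN.
exact: map_scalar_mx.
Qed.

(** The block matrix carries [b'] to [b], so the equivalence is given by its inverse, which reduces
    to the identity as well. *)
Lemma equivalent_of_block (K : fieldType)
    (b b' : 'rV[fps K]_(2 + 4) -> 'rV[fps K]_(2 + 4) -> 'rV[fps K]_(2 + 4))
    (P : 'M[fps K]_2) (W : 'M[fps K]_4) :
  map_mx (@fps_coef0 K) P = 1%:M -> map_mx (@fps_coef0 K) W = 1%:M ->
  (forall x y, b (x *m block_mx P 0 0 W) (y *m block_mx P 0 0 W) =
     b' x y *m block_mx P 0 0 W) ->
  equivalent_deformations b b'.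
Proof.
move=> /red_inverse[P' [PP' P'P P'0]] /red_inverse[W' [WW' W'W W'0]] bM.
have MN : block_mx P 0 0 W *m block_mx P' 0 0 W' = 1%:M.
  by rewrite mulmx_block !(mulmx0, mul0mx, addr0, add0r) PP' WW' -scalar_mx_block.
have NM : block_mx P' 0 0 W' *m block_mx P 0 0 W = 1%:M.
  by rewrite mulmx_block !(mulmx0, mul0mx, addr0, add0r) P'P W'W -scalar_mx_block.
have N0 : map_mx (@fps_coef0 K) (block_mx P' 0 0 W') = 1%:M.
  by rewrite map_block_mx !map_mx0 P'0 W'0 -scalar_mx_block.
exists (mulmx^~ (block_mx P' 0 0 W')); split.
- by move=> a x y; rewrite mulmxDl scalemxAl.
- move=> p x hx.
  have zN : x *m block_mx P' 0 0 W' = row_mx (lsubmx x *m P') (rsubmx x *m W').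
    by rewrite -{1}(hsubmxK x) mul_row_block !mulmx0 addr0 add0r.
  case: p hx; rewrite ?homogeneous_odd ?homogeneous_even zN => hx.
    by rewrite row_mxKl hx mul0mx.
  by rewrite row_mxKr hx mul0mx.
- move=> x; rewrite -[LHS]/(map_mx (@fps_coef0 K) _) red_mulmx N0 mulmx1.
  by apply/rowP => k; rewrite !mxE.
- move=> x y; rewrite -[constv x]mulmx1 -[constv y]mulmx1 -{1 2}NM !mulmxA bM.
  by rewrite -(mulmxA (b' _ _)) MN !mulmx1.
Qed.

Lemma metric_deformation_versal_bracket (K : numFieldType)
    (b : 'rV[fps K]_(2 + 4) -> 'rV[fps K]_(2 + 4) -> 'rV[fps K]_(2 + 4)) :
  metric_deformation (@g24_4 K) b ->
  exists2 s : fps K, s 0%N = 0 & equivalent_deformations b (versal_bracket s).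
Proof.
move=> [[lieb b0] [B metB]]; rewrite g24_4_dext in b0.
have red_b := red_bracket (dext_linear_l _ _) (dext_linear_r _ _)
  (lie_linear_l lieb) (lie_linear_r lieb) b0.
have [f f0] : exists f, map_mx (@fps_coef0 K) f = rv4 [:: 0; 1; 1; 0].
  by exists (rv4 [:: 0; 1; 1; 0]); rewrite map_rv4.
have [h h0] : exists h : fps K, fps_coef0 h * 2 = 1.
  by exists (fps_const 2^-1); rewrite mulVf // Num.Theory.pnatr_eq0.
have X0 := red_ad_odd1 red_b; have S0 := red_odd_square0 red_b.
have cv0 := red_central_vector red_b f0 h0.
have a0 : fps_coef0 (central_vector b f h 0 0) = 1.
  by move/rowP/(_ 0): cv0; rewrite [LHS]mxE [RHS]mxE.
have [|d dE] := @fps_inverse K (central_vector b f h 0 0).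
  by rewrite a0 oner_eq0.
have d0 : fps_coef0 d = 1.
  by rewrite -[LHS]mul1r -{1}a0 -fps_coef0M dE.
have [C' _ C'C] := krylov_inverse X0 f0.
have [|X' XX' _] := @mx_inverse_mod_t K _ (ad_odd b 1).
  rewrite X0 -unitfE -unitmxE.
  by have [M /mulmx1_unit[]] := dmx0_unit K.
have L0 : map_mx (@fps_coef0 K) (d *: odd_square b 0) = lmx 0.
  by rewrite redZ S0 d0 scale1r.
have Lsym : (d *: odd_square b 0)^T = d *: odd_square b 0.
  by rewrite linearZ /= tr_odd_square.
have tors := @fps_natmul_eq0 K.
have XL : ad_odd b 1 *m (d *: odd_square b 0) =
    - (d *: odd_square b 0 *m (ad_odd b 1)^T).
  by rewrite -scalemxAr (mul_odd_square lieb metB tors) scalerN scalemxAl.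
have [u [v [s [W [[uv u0] s0 W0 WX WL]]]]] := normal_form Lsym XL X0 L0.
exists s => //.
have v0 : fps_coef0 v = 1 by rewrite -[LHS]mul1r -{1}u0 -fps_coef0M uv.
pose P := rows2 (central_vector b f h) (v *: delta_mx 0 1).
apply: (@equivalent_of_block K b _ P W) => //.
  apply/row_matrixP => i; rewrite -map_row rowK row1.
  case: i => [[|[|//]] hi] /=.
    by rewrite cv0; congr (delta_mx _ _); apply: val_inj.
  by rewrite redZ v0 scale1r red_delta; congr (delta_mx _ _); apply: val_inj.
apply: (versal_bracket_morphism lieb (X := ad_odd b 1)
  (L := d *: odd_square b 0) _ _ _ _ uv WX WL).
- exact: bracket_even_even lieb metB tors.
- by move=> x; exact (central_vector_odd lieb metB tors h C'C x).
- by move=> x; exact (bracket_delta_odd lieb 1 x).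
- by move=> x y; exact (metric_structure lieb metB tors C'C XX' dE x y).
Qed.

(** * Isomorphism classes *)

(** Traces are invariant under conjugation, and (tr D^2)^2 and tr D^4 both scale by c^4. The ratio
    is cross-multiplied to make sense over any ring. *)
Lemma similar_traces (K : comNzRingType) n (D D' F F' : 'M[K]_n) c :
  F *m F' = 1%:M -> D *m F = c *: (F *m D') ->
  \tr (D *m D) ^+ 2 * \tr (D' *m D' *m (D' *m D')) =
  \tr (D' *m D') ^+ 2 * \tr (D *m D *m (D *m D)).
Proof.
move=> FF' DF; have F'F := mulmx1C FF'.
have DE : D = F *m (c *: D') *m F'.
  by rewrite -scalemxAr -DF -mulmxA FF' mulmx1.
have conjM (M N : 'M[K]_n) : F *m M *m F' *m (F *m N *m F') = F *m (M *m N) *m F'.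
  by rewrite !mulmxA -(mulmxA _ F' F) F'F mulmx1.
have trC (M : 'M[K]_n) : \tr (F *m M *m F') = \tr M.
  by rewrite mxtrace_mulC mulmxA F'F mul1mx.
rewrite {1 2 3 4 5 6}DE !conjM !trC.
rewrite -!scalemxAl -!scalemxAr -?scalemxAl -?scalemxAr !mxtraceZ.
by rewrite !expr2; ring.
Qed.

Lemma tr_dmx2 (K : comNzRingType) (s : K) :
  \tr (dmx s *m dmx s) = 4 * (1 + s).
Proof.
rewrite /mxtrace !big_ord_recl big_ord0 !mxE !big_ord_recl !big_ord0 !mxE /=.
ring.
Qed.

Lemma dmx_square (K : comNzRingType) (s : K) : dmx s *m dmx s = mx4
  [:: [:: 1 + s; 2 * s; 0; 0]; [:: 2; 1 + s; 0; 0]; [:: 0; 0; 1 + s; 2];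
      [:: 0; 0; 2 * s; 1 + s]].
Proof.
apply/matrixP => -[[|[|[|[|//]]]] ?] [[|[|[|[|//]]]] ?];
  rewrite !mxE !big_ord_recl big_ord0 !mxE /=; ring.
Qed.

Lemma tr_dmx4 (K : comNzRingType) (s : K) :
  \tr (dmx s *m dmx s *m (dmx s *m dmx s)) = 4 * (1 + 6 * s + s * s).
Proof.
rewrite dmx_square /mxtrace !big_ord_recl big_ord0 !mxE !big_ord_recl !big_ord0 !mxE /=.
ring.
Qed.

(** The factor 1 - s s' reflects a true coincidence: if s = r^2 is invertible, r times the
    eigenvalues of D(1/s) are those of D(s). The factor 256 collects the powers of 4 from the
    traces. *)
Lemma dmx_similar (K : comNzRingType) (s s' c : K) (F F' : 'M[K]_4) :
  F *m F' = 1%:M -> dmx s *m F = c *: (F *m dmx s') ->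
  ((s' - s) * (1 - s * s')) *+ 256 = 0.
Proof.
move=> FF' /(similar_traces FF'); rewrite !tr_dmx2 !tr_dmx4 => tr4.
transitivity ((4 * (1 + s)) ^+ 2 * (4 * (1 + 6 * s' + s' * s')) -
    (4 * (1 + s')) ^+ 2 * (4 * (1 + 6 * s + s * s))).
  ring.
by rewrite tr4 subrr.
Qed.

(** Only brackets of e_2 with odd basis vectors are assumed to be preserved, so that this serves
    both isomorphisms and equivalences of deformations, which are tested on constant vectors. The
    scalar c is the e_2-coordinate of f(e_2). *)
Lemma dext_intertwine (K : comNzRingType) n (D L D' L' : 'M[K]_n)
    (f : 'rV[K]_(2 + n) -> 'rV[K]_(2 + n)) :
  linear f -> even_map f ->
  (forall i, let x := even_part n (delta_mx 0 1) in
     let y := odd_part 2 (delta_mx 0 i) in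
     f (dext D L x y) = dext D' L' (f x) (f y)) ->
  let F := \matrix_i rsubmx (f (odd_part 2 (delta_mx 0 i))) in
  (forall v, f (odd_part 2 v) = odd_part 2 (v *m F)) /\
  exists c, D *m F = c *: (F *m D').
Proof.
move=> lf ef fD F.
have fO v : f (odd_part 2 v) = odd_part 2 (v *m F).
  rewrite [LHS]odd_part_homogeneous; last exact: ef (homogeneous_odd_part _).
  congr odd_part.
  apply: (linear_row_mx (f := fun w => rsubmx (f (odd_part 2 w)))).
  by move=> a x y /=; rewrite odd_part_linear lf linearP.
split=> //; exists (lsubmx (f (even_part n (delta_mx 0 1))) 0 1).
apply/row_matrixP => i; apply: (@odd_part_inj _ 2).
have dE (A B : 'M[K]_n) (p : 'rV[K]_(2 + n)) w : homogeneous false p ->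
    dext A B p (odd_part 2 w) = odd_part 2 (lsubmx p 0 1 *: (w *m A)).
  move/homogeneous_even => p0; rewrite /dext !row_mxKl !row_mxKr p0.
  rewrite !mul0mx scaler0 subr0 mxE scale0r; congr row_mx.
have := fD i; cbv zeta; rewrite dE; last exact: homogeneous_even_part.
rewrite fO [in RHS]fO dE; last exact: ef (homogeneous_even_part _).
rewrite row_mxKl mxE !eqxx scale1r => E.
by rewrite rowE mulmxA E linearZ /= !rowE !mulmxA.
Qed.

Lemma isomorphic_versal_bracket (K : fieldType) (s s' : K) :
  isomorphic (versal_bracket s) (versal_bracket s') ->
  ((s' - s) * (1 - s * s')) *+ 256 = 0.
Proof.
case=> f [lf /bij_inj finj ef fM].
have [fO [c DF]] := dext_intertwine lf ef (fun i => fM _ _).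
set F := \matrix_i _ in fO DF.
have : row_free F.
  rewrite -kermx_eq0; apply/rowV0P => v /sub_kermxP vF.
  apply: (@odd_part_inj _ 2); apply: finj.
  by rewrite fO vF fO mul0mx.
rewrite row_free_unit => Fu.
exact: (dmx_similar (mulmxV Fu) DF).
Qed.

Lemma equivalent_versal_bracket (K : fieldType) (s s' : fps K) :
  equivalent_deformations (versal_bracket s) (versal_bracket s') ->
  ((s' - s) * (1 - s * s')) *+ 256 = 0.
Proof.
case=> f [lf ef f0 fM].
have cE : even_part 4 (delta_mx 0 1) =
    constv (even_part 4 (delta_mx 0 1)) :> 'rV[fps K]_(2 + 4).
  by rewrite /constv /even_part map_row_mx map_mx0 map_delta_mx.
have cO i : odd_part 2 (delta_mx 0 i) =
    constv (odd_part 2 (delta_mx 0 i)) :> 'rV[fps K]_(2 + 4).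
  by rewrite /constv /odd_part map_row_mx map_mx0 map_delta_mx.
have [|fO [c DF]] := @dext_intertwine _ _ (dmx s) (lmx s) (dmx s') (lmx s') f lf ef.
  by move=> i; rewrite /= cE cO; exact: fM.
set F := \matrix_i _ in fO DF.
have F0 : map_mx (@fps_coef0 K) F = 1%:M.
  apply/row_matrixP => i; rewrite -map_row rowK row1 map_rsubmx cO.
  by rewrite [X in rsubmx X]f0 row_mxKr.
have [F' [FF' _ _]] := red_inverse F0.
exact: (dmx_similar FF' DF).
Qed.

Lemma isomorphic_of_block (K : comNzRingType) m n
    (b b' : 'rV[K]_(m + n) -> 'rV[K]_(m + n) -> 'rV[K]_(m + n))
    (P P' : 'M[K]_m) (W W' : 'M[K]_n) :
  P *m P' = 1%:M -> W *m W' = 1%:M ->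
  (forall x y, b (x *m block_mx P 0 0 W) (y *m block_mx P 0 0 W) =
     b' x y *m block_mx P 0 0 W) ->
  isomorphic b b'.
Proof.
move=> PP' WW' bM.
have MN : block_mx P 0 0 W *m block_mx P' 0 0 W' = 1%:M.
  by rewrite mulmx_block !(mulmx0, mul0mx, addr0, add0r) PP' WW' -scalar_mx_block.
have NM := mulmx1C MN.
exists (mulmx^~ (block_mx P' 0 0 W')); split.
- by move=> a x y; rewrite mulmxDl scalemxAl.
- by exists (mulmx^~ (block_mx P 0 0 W)) => x; rewrite -mulmxA ?MN ?NM mulmx1.
- move=> p x hx.
  have zN : x *m block_mx P' 0 0 W' = row_mx (lsubmx x *m P') (rsubmx x *m W').
    by rewrite -{1}(hsubmxK x) mul_row_block !mulmx0 addr0 add0r.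
  case: p hx; rewrite ?homogeneous_odd ?homogeneous_even zN => hx.
    by rewrite row_mxKl hx mul0mx.
  by rewrite row_mxKr hx mul0mx.
- move=> x y; rewrite -{1}[x]mulmx1 -{1}[y]mulmx1 -NM !mulmxA bM.
  by rewrite -(mulmxA (b' _ _)) MN mulmx1.
Qed.

Lemma versal_bracket_g24_3 (K : fieldType) (r : K) :
  2 != 0 :> K -> r != 0 -> 1 + r != 0 ->
  1 - r != 0 -> isomorphic (versal_bracket (r * r)) (g24_3 ((1 - r) / (1 + r))).
Proof.
move=> n2 r0 r1 r2; rewrite g24_3_dext.
(* The rows of [W] are eigenvectors of [dmx (r * r)] for 1 + r, 1 - r, - (1 + r), - (1 - r), and a
   is the e_1-coefficient of the bracket of the first with the third. Dividing e_2 by 1 + r makes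
   the first eigenvalue 1. *)
pose a := (1 + r) * (2 * r).
pose W : 'M[K]_4 := mx4 [:: [:: 1; r; 0; 0]; [:: 1; - r; 0; 0];
  [:: 0; 0; r; 1]; [:: 0; 0; r; -1]].
pose W' : 'M[K]_4 := mx4 [:: [:: 2^-1; 2^-1; 0; 0];
  [:: (2 * r)^-1; - (2 * r)^-1; 0; 0];
  [:: 0; 0; (2 * r)^-1; (2 * r)^-1]; [:: 0; 0; 2^-1; - 2^-1]].
apply: (@isomorphic_of_block _ _ _ _ _ _ (\matrix_(i, j) (if i == j then
    if i == 0 then a^-1 else 1 + r else 0)) W W'); last first.
- move=> x y; apply: (@dext_block_mx _ _ a (1 + r)^-1).
    apply/matrixP => -[[|[|[|[|//]]]] ?] [[|[|[|[|//]]]] ?];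
      rewrite !mxE !big_ord_recl !big_ord0 !mxE /=; by field.
  apply/matrixP => -[[|[|[|[|//]]]] ?] [[|[|[|[|//]]]] ?];
    rewrite !mxE !big_ord_recl !big_ord0 !mxE !big_ord_recl !big_ord0 !mxE /=;
    by rewrite /a; field.
- apply/matrixP => -[[|[|[|[|//]]]] ?] [[|[|[|[|//]]]] ?];
    rewrite !mxE !big_ord_recl !big_ord0 !mxE /=; by field; rewrite ?n2 ?r0.
- have a0 : a != 0 by rewrite !mulf_neq0.
  apply/matrixP => -[[|[|//]] ?] [[|[|//]] ?];
    rewrite !mxE !big_ord_recl !big_ord0 !mxE /=; by field; rewrite ?a0 ?r1.
Qed.

(** * The versal family *)

Definition fps_X (K : comNzRingType) : fps K := fun n => (n == 1)%:R.

(** Up to sign, the structure constants are 0, 1 and the parameter, so the substitution is computed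
    on these alone. *)
Lemma fps_subst_versal_bracket (K : comNzRingType) (s : fps K) : s 0%N = 0 ->
  reparametrize s (versal_bracket (fps_X K)) = versal_bracket s.
Proof.
move=> s0.
have sN f : fps_subst s (- f) = - fps_subst s f.
  apply/funext => n; rewrite /fps_subst -[RHS]/(- _) -sumrN.
  by apply: eq_bigr => i _; rewrite -mulNr.
have s1 : fps_subst s 1 = 1.
  apply/funext => n; rewrite /fps_subst big_ord_recl big1 ?addr0.
    by rewrite expr0 -[X in X * _]/(1 : K) mul1r.
  by move=> i _; rewrite -[X in X * _]/(0 : K) mul0r.
have sX : fps_subst s (fps_X K) = s.
  apply/funext => -[|n]; rewrite /fps_subst /fps_X big_ord_recl mul0r add0r.
    by rewrite big_ord0 s0.
  rewrite big_ord_recl /= mul1r expr1 big1 ?addr0 // => i _.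
  by rewrite mul0r.
rewrite /reparametrize map_bracket_versal_bracket ?sX //.
- apply/funext => n; rewrite /fps_subst big1 // => i _.
  by rewrite -[X in X * _]/(0 : K) mul0r.
- by rewrite sN s1.
- by rewrite sN sX.
Qed.

Lemma red_dext (K : comNzRingType) n (D L : 'M[fps K]_n) x y :
  map_mx (@fps_coef0 K) (dext D L x y) =
  dext (map_mx (@fps_coef0 K) D) (map_mx (@fps_coef0 K) L)
    (map_mx (@fps_coef0 K) x) (map_mx (@fps_coef0 K) y).
Proof.
rewrite /dext map_row_mx redZ red_delta red_pair redD redN !redZ !red_mulmx.
by rewrite !map_rsubmx ![lsubmx (map_mx _ _) _ _]mxE ![lsubmx _ _ _]mxE
  ![map_mx _ _ _ _]mxE.
Qed.

Lemma red_versal_bracket (K : comNzRingType) (s : fps K) x y :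
  map_mx (@fps_coef0 K) (versal_bracket s x y) =
  versal_bracket (fps_coef0 s) (map_mx (@fps_coef0 K) x) (map_mx (@fps_coef0 K) y).
Proof.
by rewrite /versal_bracket red_dext !map_mx4 //= !rmorphN !rmorph1 !rmorph0.
Qed.

Lemma trivial_deformation_versal_bracket (K : comNzRingType) b :
  trivial_deformation (@g24_4 K) b = equivalent_deformations b (versal_bracket 0).
Proof.
rewrite /trivial_deformation g24_4_dext map_bracket_versal_bracket ?rmorph0 //.
- exact: rmorphN1.
- by rewrite oppr0 rmorph0 oppr0.
Qed.

(** * Evaluation at complex parameters and smoothness *)

Section Convergence.
Variables (R : realType) (t : R[i]).

Lemma cvg_fps_psum (f : fps R[i]) N : (forall k, (N <= k)%N -> f k = 0) ->
  fps_psum t f x @[x --> \oo] --> (fps_psum t f N : R[i]^o).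
Proof.
move=> f0; apply: cvg_near_cst; near=> n.
have Nn : (N <= n)%N by near: n; exact: nbhs_infty_ge.
rewrite -(subnKC Nn); elim: (n - N)%N => [|k IHk]; first by rewrite addn0.
by rewrite addnS /fps_psum big_ord_recr /= f0 ?leq_addr // mul0r addr0.
Unshelve. all: by end_near. Qed.

Lemma fps_evalE (f : fps R[i]) : (forall k, (2 <= k)%N -> f k = 0) ->
  fps_eval t f = f 0%N + f 1%N * t.
Proof.
move=> f0; rewrite /fps_eval (cvg_lim _ (cvg_fps_psum f0)) //.
by rewrite /fps_psum !big_ord_recl big_ord0 /= expr0 mulr1 addr0 expr1.
Qed.

Lemma bracket_at_versal_bracket :
  bracket_at t (versal_bracket (fps_X R[i])) = versal_bracket t.
Proof.
have X0 k : (2 <= k)%N -> fps_X R[i] k = 0 by case: k => [|[|]].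
have evX : fps_eval t (fps_X R[i]) = t.
  by rewrite fps_evalE // mul1r add0r.
have ev1 : fps_eval t 1 = 1.
  by rewrite fps_evalE ?mul0r ?addr0 // => -[|[|]].
have evN f : (forall k, (2 <= k)%N -> f k = 0) -> fps_eval t (- f) = - fps_eval t f.
  move=> f0; rewrite !fps_evalE // => [|k k2].
    by rewrite -[(- f) 0%N]/(- f 0%N) -[(- f) 1%N]/(- f 1%N) mulNr opprD.
  by rewrite -[LHS]/(- f k) f0 ?oppr0.
rewrite /bracket_at map_bracket_versal_bracket ?evX //.
- by rewrite fps_evalE // mul0r addr0.
- by rewrite evN ?ev1 // => -[|[|]].
- by rewrite evN ?evX.
Qed.

Lemma converges_at_versal_bracket : converges_at t (versal_bracket (fps_X R[i])).
Proof.
pose deg1 (f : fps R[i]) := forall k, (2 <= k)%N -> f k = 0.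
suff d1 i j k : deg1 (versal_bracket (fps_X R[i]) (delta_mx 0 i) (delta_mx 0 j) 0 k).
  by move=> i j k; apply: (cvgP _ (cvg_fps_psum (d1 i j k))).
have d0 : deg1 0 by [].
have dN f : deg1 f -> deg1 (- f).
  by move=> f0 l l2; rewrite -[LHS]/(- f l) f0 ?oppr0.
have dM (c : bool) f : deg1 f -> deg1 (c%:R * f).
  by case: c => f0; rewrite ?mul1r ?mul0r.
have d11 : deg1 1 by move=> [|[|]].
have dX : deg1 (fps_X R[i]) by move=> [|[|]].
have dD (a b : 'I_4) : deg1 (dmx (fps_X R[i]) a b).
  rewrite mxE; case: a b => [[|[|[|[|//]]]] ?] [[|[|[|[|//]]]] ?] //=;
  exact: dN.
have dL (a b : 'I_4) : deg1 (lmx (fps_X R[i]) a b).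
  by rewrite mxE; case: a b => [[|[|[|[|//]]]] ?] [[|[|[|[|//]]]] ?].
rewrite /versal_bracket dext_delta.
case: (fintype.split i) => a; case: (fintype.split j) => b;
  case: (split_ordP k) => l ->; rewrite ?row_mxEl ?row_mxEr ![_ 0 _]mxE //.
- exact: dM.
- by apply: dN; exact: dM.
- by rewrite mulrC; exact: dM.
Qed.

End Convergence.

Import Order.TTheory Num.Theory numFieldNormedType.Exports.

Lemma smooth_versal_bracket (R : realType) :
  smooth_deformation (versal_bracket (fps_X R[i])).
Proof.
(* In the unit disc the coincidence t t' = 1 is impossible. *)
exists (ball (0 : R[i]^o) 1); first exact: nbhsx_ballx.
split=> [t _|t t' Ut Ut' _ _ tt']; first exact: converges_at_versal_bracket.
rewrite !bracket_at_versal_bracket => /isomorphic_versal_bracket/eqP.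
rewrite mulrn_eq0 /= mulf_eq0 !subr_eq0 (negbTE (_ : t' != t)) 1?eq_sym //=.
move: Ut Ut'; rewrite /ball /= !sub0r !normrN => Ut Ut' /eqP tt1.
have : `|t : R[i]| * `|t' : R[i]| < 1 by apply: mulr_ilt1.
by rewrite -normrM tt1 normr1 ltxx.
Qed.

(** Whatever branch of the root is chosen, the square of its modulus is the modulus of t. *)
Lemma sqrtC_cvg0 (R : realType) :
  (sqrtC t : R[i]^o) @[t --> (0 : R[i]^o)^'] --> (0 : R[i]^o).
Proof.
apply/cvgr0Pnorm_lt => e e0; near=> t.
have : `|t| < e ^+ 2.
  by near: t; apply: dnbhs0_lt; rewrite exprn_gt0.
rewrite -{1}(sqrtCK t) normrX ltr_pXn2r // nnegrE // ltW //.
Unshelve. all: by end_near. Qed.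

Lemma cayley_cvg (K : numFieldType) (T : Type) (F : set_system T) (f : T -> K^o) :
  Filter F -> f x @[x --> F] --> (0 : K^o) ->
  ((1 - f x) / (1 + f x) : K^o) @[x --> F] --> (1 : K^o).
Proof.
move=> FF f0.
have num : (1 - f x : K^o) @[x --> F] --> (1 - 0 : K^o).
  by apply: cvgB => //; exact: cvg_cst.
have den : (1 + f x : K^o) @[x --> F] --> (1 + 0 : K^o).
  by apply: cvgD => //; exact: cvg_cst.
rewrite subr0 in num; rewrite addr0 in den.
have inv : ((1 + f x)^-1 : K^o) @[x --> F] --> (1^-1 : K^o).
  by apply: cvgV => //; exact: oner_neq0.
have h := cvgM num inv; rewrite invr1 mulr1 in h.
exact: h.
Qed.

Lemma smooth_deformation_to_g24_3 (R : realType) :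
  smooth_deformation_to (versal_bracket (fps_X R[i])) [set l : R[i] | l != 0]
    (@g24_3 R[i]) 1.
Proof.
split; first exact: smooth_versal_bracket.
(* The quotient of two eigenvalues; the other root of t would give its inverse. *)
exists (fun t => (1 - sqrtC t) / (1 + sqrtC t)); split.
  near=> t.
  have t0 : t != 0 by near: t; exact: nbhs_dnbhs_neq.
  have t1 : `|t| < 1 by near: t; exact: dnbhs0_lt.
  have r0 : sqrtC t != 0 by rewrite sqrtC_eq0.
  have r1 : `|sqrtC t| < 1.
    by move: t1; rewrite -{1}(sqrtCK t) normrX expr_lt1.
  have rp : 1 + sqrtC t != 0.
    by rewrite addrC addr_eq0; apply: contraTN r1 => /eqP ->; rewrite normrN1 ltxx.
  have rm : 1 - sqrtC t != 0.
    by rewrite subr_eq0 eq_sym; apply: contraTN r1 => /eqP ->; rewrite normr1 ltxx.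
  split; first by rewrite /= mulf_neq0 // invr_eq0.
  rewrite bracket_at_versal_bracket -{1}(sqrtCK t) expr2; exact: versal_bracket_g24_3.
have r0 := sqrtC_cvg0 (R := R).
exact: cayley_cvg r0.
Unshelve. all: by end_near. Qed.

Theorem theorem3p4p4 (R : realType) :
  exists b : 'rV[fps R[i]]_(2 + 4) -> 'rV[fps R[i]]_(2 + 4) -> 'rV[fps R[i]]_(2 + 4),
    [/\ metric_deformation (@g24_4 R[i]) b,
        ~ trivial_deformation (@g24_4 R[i]) b,
        (forall b' : 'rV[fps R[i]]_(2 + 4) -> 'rV[fps R[i]]_(2 + 4) ->
                     'rV[fps R[i]]_(2 + 4),
           metric_deformation (@g24_4 R[i]) b' ->
           ~ trivial_deformation (@g24_4 R[i]) b' ->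
           exists s : fps R[i],
             [/\ s 0%N = 0, s <> 0 &
                 equivalent_deformations b' (reparametrize s b)]) &
        smooth_deformation_to b [set l : R[i] | l != 0] (@g24_3 R[i]) 1].
Proof.
have b_metric : metric_deformation (@g24_4 R[i]) (versal_bracket (fps_X R[i])).
  split; last by exists (dext_form (symplectic_mx (fps R[i])));
    exact: versal_bracket_metric.
  split; first exact: versal_bracket_lie.
  move=> x y; rewrite g24_4_dext -[LHS]/(map_mx (@fps_coef0 R[i]) _) red_versal_bracket.
  by congr (versal_bracket _ _ _); apply/rowP => k; rewrite !mxE.
exists (versal_bracket (fps_X R[i])); split=> //.
(* Triviality would make the parameters t and 0 equivalent, and the trace invariant would then give
   -256 t = 0. *)
- rewrite trivial_deformation_versal_bracket =>
    /equivalent_versal_bracket/fps_natmul_eq0.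
  rewrite mulr0 subr0 mulr1 sub0r => /(congr1 (@^~ 1%N)) /eqP.
  by rewrite -[X in X == _]/(- 1 : R[i]) oppr_eq0 oner_eq0.
- move=> b' /metric_deformation_versal_bracket[s s0 b's] nontriv; exists s; split=> //.
    by move=> sE; apply: nontriv; rewrite trivial_deformation_versal_bracket -sE.
  by rewrite fps_subst_versal_bracket.
- exact: smooth_deformation_to_g24_3.
Qed.
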